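(* Let $M>0$, let $\mu$ be a probability law supported on $[0,M]$, and let $c(\cdot)$ denote either the algebraic threshold $c_{\mathrm{alg}}(\cdot)$ or the susceptibility threshold $c_\chi(\cdot)$ of the averaged XY model on $\mathbb Z^2$ with i.i.d. bond strengths (the choice being kept fixed). Suppose $0<c(\mu)<\infty$ and that all competing laws $\nu$ are supported on $[0,M]$. Write $\delta=\|\nu-\mu\|_{\mathrm{TV}}=\sup_A|\nu(A)-\mu(A)|$ and $H_M(t)=1-e^{-2Mt}$. (1) If $a=\mu(\{M\})>0$, then, for $\delta<a\,e^{-2Mc(\mu)}$, $$\frac{H_M(c(\mu))}{1+\delta/a}\le H_M(c(\nu))\le\frac{H_M(c(\mu))}{1-\delta/a}<1.$$ In particular $c$ is locally Lipschitz in total variation at $\mu$ (there is a total-variation neighborhood of $\mu$ among laws on $[0,M]$ on which $c$ is finite and Lipschitz with respect to total variation), and, with $\mu$ fixed, $$|c(\nu)-c(\mu)|\le\frac{e^{2Mc(\mu)}-1}{2Ma}\,\delta+O(\delta^2)\qquad(\delta\to0).$$ (2) More generally, if $\operatorname{ess\,sup}\mu=M$, then $c$ is continuous at $\mu$ in total variation among laws on $[0,M]$, without requiring an atom at $M$.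
   Context: XY model. Let $\mathbb T=\mathbb R/(2\pi\mathbb Z)$. For a finite graph $G=(V,E)$ and couplings $K_e\ge0$, the XY Gibbs measure with free boundary conditions is $$d\mu_{G,K}(\theta)=\frac1{Z_{G,K}}\exp\Bigl(\sum_{e=\{u,v\}\in E}K_e\cos(\theta_u-\theta_v)\Bigr)\prod_{v\in V}\frac{d\theta_v}{2\pi},\qquad\theta\in\mathbb T^V.$$ Averaged correlation. For a law $\mu$ on $[0,M]$, put couplings $K_e=\beta J_e$, with $(J_e)$ i.i.d. of law $\mu$, on the nearest-neighbor edges of $\mathbb Z^2$. $F_\mu(\beta;x,y)$ is the limit, as the box $[-R,R]^2\cap\mathbb Z^2$ (free boundary conditions) increases to $\mathbb Z^2$, of the disorder expectation of the finite-volume Gibbs expectation of $\cos(\theta_x-\theta_y)$ (each Gibbs expectation is normalized before averaging); it exists by Ginibre monotonicity. Thresholds. $$c_{\mathrm{alg}}(\mu)=\inf\bigl\{\beta\ge0:\ \exists\,c_0>0,\ s\in[0,\infty)\text{ with }F_\mu(\beta;0,x)\ge c_0(1+|x|)^{-s}\text{ for every }x\in\mathbb Z^2\setminus\{0\}\bigr\},$$ $$c_\chi(\mu)=\inf\Bigl\{\beta\ge0:\ \sum_{x\in\mathbb Z^2}F_\mu(\beta;0,x)=\infty\Bigr\},$$ with $\inf\varnothing=\infty$ (and $H_M(\infty)=1$). The supremum in the total variation distance is over Borel sets $A$. $\operatorname{ess\,sup}\mu=\inf\{t:\mu((t,\infty))=0\}$. *)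

(* Defs.v *)
From HB Require Import structures.
From mathcomp Require Import all_boot all_order all_algebra.
From mathcomp Require Import all_classical all_reals all_analysis measurable_realfun.

Set Implicit Arguments.
Unset Strict Implicit.
Unset Printing Implicit Defensive.
Import Order.TTheory GRing.Theory Num.Theory.
Import numFieldNormedType.Exports.

Local Open Scope classical_set_scope.
Local Open Scope ring_scope.

Notation law R := (probability (measurableTypeR R) R).

Section product_probability.
Context d (T : measurableType d) (R : realType) (P : probability T R).

Definition cons_tuple n (x : T * n.-tuple T) : n.+1.-tuple T :=
  [the n.+1.-tuple T of x.1 :: x.2].

Lemma measurable_cons_tuple n : measurable_fun [set: T * n.-tuple T] (@cons_tuple n).
Proof. exact: measurable_cons. Qed.

HB.instance Definition _ n := isMeasurableFun.Build _ _ _ _ (@cons_tuple n)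
  (@measurable_cons_tuple n).

(* P ^ n: the law of n independent samples of P. *)
Fixpoint pprod n : probability (n.-tuple T) R :=
  match n with
  | 0 => dirac ([tuple] : 0.-tuple T)
  | m.+1 => distribution (P \x pprod m)%E (@cons_tuple m)
  end.

End product_probability.

Section xy_gibbs.
Context (R : realType).

Lemma two_pi_gt0 : 0 < 2 * pi :> R.
Proof. by rewrite mulr_gt0// pi_gt0. Qed.

(* The circle R / 2 pi Z is represented by its fundamental domain [0, 2 pi], so
   that this is d theta / 2 pi; observables only involve angles through cos. *)
Definition circle_law : law R := uniform_prob two_pi_gt0.

(* A finite graph: vertices V, edges E, and the two endpoints of each edge (in
   an order that is irrelevant because cos is even). *)
Context (V E : finType) (ends : E -> V * V) (K : E -> R).

(* A configuration in T^V is a tuple indexed by the enumeration of V. *)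
Notation config := (#|V|.-tuple (measurableTypeR R)).

Definition angle (theta : config) (v : V) : R := tnth theta (enum_rank v).

Definition free_measure : probability config R := pprod circle_law #|V|.

Definition xy_weight (theta : config) : R :=
  expR (\sum_(e : E) K e * cos (angle theta (ends e).1 - angle theta (ends e).2)).

Definition xy_Z : R := \int[free_measure]_theta xy_weight theta.

Definition xy_gibbs (A : set config) : \bar R :=
  (\int[free_measure]_(theta in A) (xy_Z^-1 * xy_weight theta)%:E)%E.

Lemma measurable_angle v : measurable_fun setT (angle ^~ v).
Proof. exact: measurable_tnth. Qed.

Lemma measurable_xy_weight : measurable_fun setT xy_weight.
Proof.
apply: measurableT_comp => //; apply: measurable_sum => e.
apply: measurable_funM => //; apply: measurableT_comp.
  exact: (continuous_measurable_fun (@continuous_cos R)).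
by apply: measurable_funB; exact: measurable_angle.
Qed.

Lemma xy_density_ge0 theta : 0 <= xy_Z^-1 * xy_weight theta.
Proof.
by rewrite mulr_ge0 ?expR_ge0// invr_ge0 Rintegral_ge0// => x _; exact: expR_ge0.
Qed.

Let xy_gibbs0 : xy_gibbs set0 = 0%E.
Proof. by rewrite /xy_gibbs integral_set0. Qed.

Let xy_gibbs_ge0 A : (0 <= xy_gibbs A)%E.
Proof. by apply: integral_ge0 => x _; rewrite lee_fin xy_density_ge0. Qed.

Let xy_gibbs_sigma_additive : semi_sigma_additive xy_gibbs.
Proof.
move=> /= A mA tA mUA; rewrite /xy_gibbs/= ge0_integral_bigcup//=; last 2 first.
- apply: measurable_funTS; apply/measurable_EFinP; apply: measurable_funM => //.
  exact: measurable_xy_weight.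
- by move=> x _; rewrite lee_fin xy_density_ge0.
apply: is_cvg_ereal_nneg_natsum_cond => n _ _.
by apply: integral_ge0 => /= x _; rewrite lee_fin xy_density_ge0.
Qed.

HB.instance Definition _ := isMeasure.Build _ _ _ xy_gibbs
  xy_gibbs0 xy_gibbs_ge0 xy_gibbs_sigma_additive.

End xy_gibbs.

Definition xy_corr (R : realType) (V E : finType) (ends : E -> V * V)
    (K : E -> R) (x y : V) : R :=
  \int[xy_gibbs ends K]_theta cos (angle theta x - angle theta y).

(* The box [-r, r]^2 of Z^2, translated by (r, r). *)
Notation box r := ('I_(r.*2.+1) * 'I_(r.*2.+1))%type.

Section box_graph.
Context (r : nat).

(* Each nearest-neighbour bond is listed once, from its left or lower end. *)
Definition box_bond (p : box r * box r) : bool :=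
  ((p.2.1 == p.1.1.+1 :> nat) && (p.2.2 == p.1.2 :> nat)) ||
  ((p.2.1 == p.1.1 :> nat) && (p.2.2 == p.1.2.+1 :> nat)).

Definition box_edge : finType := {p : box r * box r | box_bond p}.

Definition box_ends (e : box_edge) : box r * box r := val e.

(* Meaningful when x lies in [-r, r]^2, that is, for all large r. *)
Definition to_box (x : int * int) : box r :=
  (inord `|(x.1 + r%:Z)%R|%N, inord `|(x.2 + r%:Z)%R|%N).

End box_graph.

Section averaged_model.
Context (R : realType).
Implicit Types (mu nu : law R) (beta M : R) (x y : int * int).

Definition box_averaged_corr mu beta r x y : R :=
  \int[pprod mu #|box_edge r|]_J
    xy_corr (@box_ends r) (fun e => beta * tnth J (enum_rank e))
            (to_box r x) (to_box r y).

Definition averaged_corr mu beta x y : R :=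
  lim (box_averaged_corr mu beta r x y @[r --> \oo]).

Definition euclid_norm x : R := Num.sqrt (x.1%:~R ^+ 2 + x.2%:~R ^+ 2).

Definition c_alg mu : \bar R :=
  ereal_inf [set beta%:E | beta in [set beta : R | 0 <= beta /\
    exists c0 s : R, [/\ 0 < c0, 0 <= s &
      forall x, x != (0, 0) ->
        c0 * (1 + euclid_norm x) `^ (- s) <= averaged_corr mu beta (0, 0) x]]].

Definition c_chi mu : \bar R :=
  ereal_inf [set beta%:E | beta in [set beta : R | 0 <= beta /\
    (\esum_(x in [set: int * int]) (averaged_corr mu beta (0, 0) x)%:E = +oo)%E]].

Definition law_on M mu : Prop := mu [set` `[0, M]] = 1%E.

Definition tv_dist nu mu : R :=
  sup [set `|fine (nu A) - fine (mu A)| | A in measurable].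

Definition law_ess_sup mu : \bar R :=
  ereal_inf [set t%:E | t in [set t : R | mu [set` `]t, +oo[] = 0%E]].

(* 1 - exp (- 2 M t), with the value 1 at t = +oo. *)
Definition HM M (t : \bar R) : R := 1 - fine (expeR (- ((2 * M)%:E * t))%E).

End averaged_model.

(* Main.v *)
From HB Require Import structures.
Require Import Defs.
From mathcomp Require Import all_boot all_order all_algebra.
From mathcomp Require Import all_classical all_reals all_analysis.
From mathcomp Require Import measurable_realfun ring lra zify.

Set Implicit Arguments.
Unset Strict Implicit.
Unset Printing Implicit Defensive.
Import Order.TTheory GRing.Theory Num.Theory.
Import numFieldNormedType.Exports.

Local Open Scope classical_set_scope.
Local Open Scope ring_scope.

(** Write f(k) for a finite-volume correlation as a function of the coupling k
    of one bond, all the other couplings being fixed and nonnegative, and put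
    H(k) = 1 - exp(-2k).  Everything rests on two monotonicity properties on
    k >= 0 ([bond_response]): f is nondecreasing, and so is the quotient
    (f(k) - f(0)) / H(k); the second one says that f keeps growing at least as
    fast as the clock H.  With c the cosine carried by the bond,
    f' = <F;c>  and  f'' + 2f' = <F;c^2> + 2(1 - <c>)<F;c>,
    so both properties follow from the nonnegativity of the truncated
    correlations of F with c and with c^2 ([tilted_bond_response]), that is, from
    Ginibre's inequality ([ginibre]).  The latter is proved by duplicating the
    spins: the substitution (a, b) -> (a + b, a - b) preserves Haar measure on
    the doubled torus ([torus_duplication]) and turns the covariance into the
    integral of a kernel which is a limit of sums of products Phi(a) Phi(b),
    whence a limit of sums of squares ([split_kernel_exp_ge0]).

    Now compare two bond laws P and Q at total variation distance d, with inverse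
    temperature b' for P and b <= b' for Q.  Replacing Q by P in one bond costs at
    most d (f(bM) - f(0)), while the bonds of strength at least m, of P-mass p,
    bring in at least p (f(b'm) - f(bM)).  By the monotonicity of the quotient the
    balance is favourable as soon as (p + d) H(bM) <= p H(b'm), a condition in
    which neither f nor the graph appears ([one_bond_comparison]).  It can hence
    be used bond after bond ([all_bonds_comparison]) and passes to the infinite
    volume, where the limit exists because larger boxes only add bonds
    ([is_cvg_box_averaged_corr]).  Each of the two thresholds is an infimum over
    the b at which the averaged correlations are large in a sense that is
    inherited by larger correlations, so if b is such for Q, then c(P) <= b'
    ([thresholdP]).

    When P has an atom of mass p at M, take m = M and let b' turn the condition
    into an equality: this yields
    p HM(c(P)) <= (p + d) HM(c(Q))  ([atom_comparison]).
    With (P, Q) = (mu, nu) and (nu, mu) these are the two bounds of the first part;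
    with two laws near mu they give the Lipschitz property, and expanding
    the exponential gives the first-order estimate.  Without an atom, the
    positive mass of ]m, M] for m close to M makes the same condition
    satisfiable for any b < b' when d is small ([ess_sup_window]). *)

(** * Means of bounded measurable functions *)

Section bounded_measurable.
Context {R : realType}.

Definition bmeas d (T : measurableType d) (f : T -> R) :=
  measurable_fun setT f /\ exists B, forall x, `|f x| <= B.

Section ops.
Context d (T : measurableType d).
Implicit Types f g : T -> R.

Lemma bmeas_cst (r : R) : bmeas (fun _ : T => r).
Proof. by split; [exact: measurable_cst | exists `|r|]. Qed.

Lemma bmeasD f g : bmeas f -> bmeas g -> bmeas (fun x => f x + g x).
Proof.
move=> [mf [B fB]] [mg [C gC]]; split; first exact: measurable_funD.
by exists (B + C) => x; rewrite (le_trans (ler_normD _ _))// lerD.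
Qed.

Lemma bmeasM f g : bmeas f -> bmeas g -> bmeas (fun x => f x * g x).
Proof.
move=> [mf [B fB]] [mg [C gC]]; split; first exact: measurable_funM.
by exists (B * C) => x; rewrite normrM ler_pM.
Qed.

Lemma bmeasZ r f : bmeas f -> bmeas (fun x => r * f x).
Proof. by apply: bmeasM; exact: bmeas_cst. Qed.

Lemma bmeasB f g : bmeas f -> bmeas g -> bmeas (fun x => f x - g x).
Proof.
move=> [mf [B fB]] [mg [C gC]]; split; first exact: measurable_funB.
by exists (B + C) => x; rewrite (le_trans (ler_normB _ _))// lerD.
Qed.

Lemma bmeasX f n : bmeas f -> bmeas (fun x => f x ^+ n).
Proof.
move=> bf; elim: n => [|n IHn]; first exact: bmeas_cst.
by under eq_fun do rewrite exprS; exact: bmeasM.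
Qed.

Lemma bmeas_sum I (r : seq I) (P : pred I) (F : I -> T -> R) :
  (forall i, P i -> bmeas (F i)) -> bmeas (fun x => \sum_(i <- r | P i) F i x).
Proof.
move=> bF; elim: r => [|i r IHr].
  by under eq_fun do rewrite big_nil; exact: bmeas_cst.
under eq_fun do rewrite big_cons.
by case: (boolP (P i)) => Pi //; apply: bmeasD => //; exact: bF.
Qed.

Lemma bmeas_expR f : bmeas f -> bmeas (fun x => expR (f x)).
Proof.
move=> [mf [B fB]]; split; first exact: measurableT_comp.
exists (expR B) => x; rewrite ger0_norm ?expR_ge0// ler_expR.
by rewrite (le_trans (ler_norm _)).
Qed.

Lemma bmeas_cos f : measurable_fun setT f -> bmeas (fun x => cos (f x)).
Proof.
move=> mf; split.
  by apply: measurableT_comp => //; exact: (continuous_measurable_fun (@continuous_cos R)).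
by exists 1 => x; rewrite ler_norml cos_geN1 cos_le1.
Qed.

Lemma bmeas_sin f : measurable_fun setT f -> bmeas (fun x => sin (f x)).
Proof.
move=> mf; split.
  by apply: measurableT_comp => //; exact: (continuous_measurable_fun (@continuous_sin R)).
by exists 1 => x; rewrite ler_norml sin_geN1 sin_le1.
Qed.

Lemma bmeas_indic (A : set T) : measurable A -> bmeas (fun x => \1_A x).
Proof.
move=> mA; split; first exact: measurable_indic.
by exists 1 => x; rewrite indicE; case: (x \in A); rewrite ?normr1 ?normr0.
Qed.

Lemma bmeas_integrable (P : probability T R) f :
  bmeas f -> P.-integrable setT (EFin \o f).
Proof.
move=> [mf [B fB]]; apply: measurable_bounded_integrable => //.
  by rewrite (le_lt_trans (probability_le1 P measurableT))// ltry.
by exists B; split; [exact: num_real | move=> C BC x _; exact: le_trans (ltW BC)].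
Qed.

End ops.

Lemma bmeas_comp d1 d2 (T1 : measurableType d1) (T2 : measurableType d2)
    (f : T2 -> R) (g : T1 -> T2) :
  bmeas f -> measurable_fun setT g -> bmeas (fun x => f (g x)).
Proof.
by move=> [mf [B fB]] mg; split; [exact: measurableT_comp | exists B].
Qed.


Section expectation.
Context d (T : measurableType d) (P : probability T R).
Implicit Types f g : T -> R.

Lemma expect_cst r : \int[P]_x r = r.
Proof.
rewrite Rintegral_cst// -[RHS]mulr1; congr (_ * _).
exact: (congr1 fine (probability_setT P)).
Qed.

Lemma expectD f g : bmeas f -> bmeas g ->
  \int[P]_x (f x + g x) = \int[P]_x f x + \int[P]_x g x.
Proof. by move=> bf bg; rewrite RintegralD//; exact: bmeas_integrable. Qed.

Lemma expectB f g : bmeas f -> bmeas g ->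
  \int[P]_x (f x - g x) = \int[P]_x f x - \int[P]_x g x.
Proof. by move=> bf bg; rewrite RintegralB//; exact: bmeas_integrable. Qed.

Lemma expectZ r f : bmeas f -> \int[P]_x (r * f x) = r * \int[P]_x f x.
Proof. by move=> bf; rewrite RintegralZl//; exact: bmeas_integrable. Qed.

Lemma expectZr r f : bmeas f -> \int[P]_x (f x * r) = (\int[P]_x f x) * r.
Proof. by move=> bf; rewrite RintegralZr//; exact: bmeas_integrable. Qed.

Lemma expect_sum I (s : seq I) (F : I -> T -> R) :
  (forall i, bmeas (F i)) ->
  \int[P]_x (\sum_(i <- s) F i x) = \sum_(i <- s) \int[P]_x F i x.
Proof.
move=> bF; elim: s => [|i s IHs].
  by under eq_Rintegral do rewrite big_nil; rewrite expect_cst big_nil.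
under eq_Rintegral do rewrite big_cons.
by rewrite expectD ?big_cons ?IHs//; exact: bmeas_sum.
Qed.

Lemma le_expect f g : bmeas f -> bmeas g -> (forall x, f x <= g x) ->
  \int[P]_x f x <= \int[P]_x g x.
Proof.
by move=> bf bg fg; apply: le_Rintegral => //; exact: bmeas_integrable.
Qed.

Lemma expect_abs_le f B : bmeas f -> (forall x, `|f x| <= B) ->
  `|\int[P]_x f x| <= B.
Proof.
move=> bf fB; rewrite ler_norml; apply/andP; split.
  rewrite -[leLHS]expect_cst; apply: le_expect => // [|x]; first exact: bmeas_cst.
  by have := fB x; rewrite ler_norml => /andP[].
rewrite -[leRHS]expect_cst; apply: le_expect => // [|x]; first exact: bmeas_cst.
by have := fB x; rewrite ler_norml => /andP[].
Qed.

Lemma expect_gt0 f : bmeas f -> (exists2 e, 0 < e & forall x, e <= f x) ->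
  0 < \int[P]_x f x.
Proof.
move=> bf [e e0 ef]; apply: (lt_le_trans e0); rewrite -[leLHS]expect_cst.
by apply: le_expect => //; exact: bmeas_cst.
Qed.

Lemma expect_indic (A : set T) : measurable A -> \int[P]_x \1_A x = fine (P A).
Proof. by move=> mA; rewrite /Rintegral integral_indic// setIT. Qed.

End expectation.

Section fubini.
Context d1 d2 (T1 : measurableType d1) (T2 : measurableType d2).
Context (P1 : probability T1 R).

Lemma bmeas_section1 (f : T1 * T2 -> R) x : bmeas f -> bmeas (fun y => f (x, y)).
Proof. by move=> bf; apply: (bmeas_comp bf); exact: measurable_pair1. Qed.

Lemma bmeas_section2 (f : T1 * T2 -> R) y : bmeas f -> bmeas (fun x => f (x, y)).
Proof. by move=> bf; apply: (bmeas_comp bf); exact: measurable_pair2. Qed.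

Lemma bmeas_swap (f : T1 * T2 -> R) : bmeas f -> bmeas (fun z => f (z.2, z.1)).
Proof.
move=> bf; apply: (bmeas_comp bf).
by apply: measurable_fun_pair; [exact: measurable_snd|exact: measurable_fst].
Qed.

Lemma EFin_expect (f : T1 -> R) : bmeas f ->
  (\int[P1]_x f x)%:E = (\int[P1]_x (f x)%:E)%E.
Proof.
move=> bf; rewrite /Rintegral fineK//.
by apply: integrable_fin_num => //; exact: bmeas_integrable.
Qed.

End fubini.

(** Measurability in the remaining variable comes from Fubini's theorem, for
    which any probability on that variable will do; hence the Dirac mass. *)
Lemma bmeas_expect d1 d2 (T1 : measurableType d1) (T2 : measurableType d2)
  (P2 : probability T2 R) (f : T1 * T2 -> R) :
  bmeas f -> bmeas (fun x => \int[P2]_y f (x, y)).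
Proof.
move=> bf; split; last first.
  have [_ [B fB]] := bf; exists B => x; apply: expect_abs_le => //.
  exact: bmeas_section1.
apply/measurable_EFinP.
rewrite [X in measurable_fun _ X](_ : _ =
    fubini_F P2 (EFin \o f)); last first.
  by apply/funext => x /=; rewrite EFin_expect//; exact: bmeas_section1.
pose D := dirac (point : T1) : probability T1 R.
by apply: (@measurable_fubini_F _ _ _ _ _ D); exact: (bmeas_integrable (D \x P2)%E).
Qed.

Lemma fubini_expect d1 d2 (T1 : measurableType d1) (T2 : measurableType d2)
  (P1 : probability T1 R) (P2 : probability T2 R) (f : T1 * T2 -> R) :
  bmeas f ->
  \int[P1]_x \int[P2]_y f (x, y) = \int[P2]_y \int[P1]_x f (x, y).
Proof.
move=> bf; congr fine.
under eq_integral => x _ do rewrite (EFin_expect P2 (bmeas_section1 x bf)).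
under [RHS]eq_integral => y _ do rewrite (EFin_expect P1 (bmeas_section2 y bf)).
by apply: (@Fubini _ _ _ _ _ P1 P2 (EFin \o f)); exact: (bmeas_integrable (P1 \x P2)%E).
Qed.

Lemma expect_prod d1 d2 (T1 : measurableType d1) (T2 : measurableType d2)
  (P1 : probability T1 R) (P2 : probability T2 R) (f : T1 * T2 -> R) :
  bmeas f ->
  \int[(P1 \x P2)%E]_z f z = \int[P1]_x \int[P2]_y f (x, y).
Proof.
move=> bf; congr fine.
under [RHS]eq_integral => x _ do rewrite (EFin_expect P2 (bmeas_section1 x bf)).
by rewrite -(@integral12_prod_meas1 _ _ _ _ _ P1 P2 (EFin \o f))//;
  exact: (bmeas_integrable (P1 \x P2)%E).
Qed.

Lemma expect_distribution d1 d2 (T1 : measurableType d1) (T2 : measurableType d2)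
  (P1 : probability T1 R) (X : {mfun T1 >-> T2}) (f : T2 -> R) :
  bmeas f -> \int[distribution P1 X]_y f y = \int[P1]_x f (X x).
Proof.
move=> bf; congr fine; rewrite integral_distribution//.
- by apply/measurable_EFinP; case: bf.
- by apply: (@bmeas_integrable _ _ P1 (fun x => f (X x))); exact: bmeas_comp.
Qed.

Section pprod.
Context d (T : measurableType d) (P : probability T R).

Lemma bmeas_cons n (f : n.+1.-tuple T -> R) :
  bmeas f -> bmeas (fun z : T * n.-tuple T => f (Defs.cons_tuple z)).
Proof. by move=> bf; apply: bmeas_comp => //; exact: Defs.measurable_cons_tuple. Qed.

Lemma expect_pprodS n (f : n.+1.-tuple T -> R) : bmeas f ->
  \int[pprod P n.+1]_J f J = \int[P]_x \int[pprod P n]_J f (Defs.cons_tuple (x, J)).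
Proof.
by move=> bf; rewrite expect_distribution// expect_prod//; exact: bmeas_cons.
Qed.

Lemma expect_pprod0 (f : 0.-tuple T -> R) : bmeas f ->
  \int[pprod P 0]_J f J = f [tuple].
Proof.
move=> bf; rewrite (@eq_Rintegral _ _ _ _ _ (cst (f [tuple]))) ?expect_cst//.
by move=> x _; rewrite tuple0.
Qed.

End pprod.

End bounded_measurable.

(** * The response of a correlation to one bond *)

Section single_bond_calculus.
Context {R : realType}.

Definition bondH (k : R) : R := 1 - expR (- (2 * k)).

Lemma bondH0 : bondH 0 = 0.
Proof. by rewrite /bondH mulr0 oppr0 expR0 subrr. Qed.

Lemma bondH_mono : {mono bondH : x y / x <= y}.
Proof.
by move=> x y; rewrite /bondH lerD2l lerN2 ler_expR lerN2 ler_pM2l// ltr0n.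
Qed.

Lemma bondH_ge0 k : 0 <= k -> 0 <= bondH k.
Proof. by move=> k0; rewrite -[leLHS]bondH0 bondH_mono. Qed.

Lemma bondH_gt0 k : (0 < bondH k) = (0 < k).
Proof. by rewrite -[ltLHS]bondH0 (leW_mono bondH_mono). Qed.

Lemma bondH_lt1 k : bondH k < 1.
Proof. by rewrite /bondH ltrBlDr ltrDl expR_gt0. Qed.

(** The quotient (f(k) - f(0)) / H(k) is nondecreasing; cross-multiplied because
    H vanishes at 0. *)
Definition bond_response (f : R -> R) :=
  (forall k k' : R, 0 <= k -> k <= k' -> f k <= f k') /\
  (forall k k' : R, 0 <= k -> k <= k' ->
     (f k - f 0) * bondH k' <= (f k' - f 0) * bondH k).

Lemma is_derive_continuous (f : R -> R) (df : R -> R) (A : set R) :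
  (forall x : R, is_derive x 1 f (df x)) -> {within A, continuous f}.
Proof.
move=> fd; apply: continuous_subspaceT => x; apply: differentiable_continuous.
by apply/derivable1_diffP; have [] := fd x.
Qed.

(** The third hypothesis says that f is convex in the variable H(k), since
    dH = 2 exp(-2k) dk; a convex function has increasing slopes from 0.  If the
    chord from 0 to k' were crossed upwards at k, the mean value theorem on
    [0, k] and on [k, k'] would contradict that hypothesis. *)
Lemma bond_response_derive (f df : R -> R) :
  (forall k : R, is_derive k 1 f (df k)) ->
  (forall k : R, 0 <= k -> 0 <= df k) ->
  (forall k k' : R, 0 <= k -> k <= k' -> expR (2 * k) * df k <= expR (2 * k') * df k') ->
  bond_response f.
Proof.
move=> fd df0 dfmono; split => k k' k0.
  rewrite le_eqVlt => /predU1P[->//|kk'].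
  have [c] := MVT kk' (fun x _ => fd x) (@is_derive_continuous _ _ _ fd).
  rewrite in_itv/= => /andP[kc _] fE; rewrite -subr_ge0 fE mulr_ge0 ?subr_ge0 ?(ltW kk')//.
  by rewrite df0// (le_trans k0)// ltW.
rewrite le_eqVlt => /predU1P[->//|kk'].
have [->|kn0] := eqVneq k 0; first by rewrite subrr mul0r bondH0 mulr0.
have {kn0}k_gt0 : 0 < k by rewrite lt_neqAle eq_sym kn0.
have Hk'0 : 0 < bondH k' by rewrite bondH_gt0 (lt_trans k_gt0).
pose l := (f k' - f 0) / bondH k'.
pose psi t := f t - l * bondH t.
pose dpsi t := df t - l * (2 * expR (- (2 * t))).
have psid (t : R) : is_derive t 1 psi (dpsi t).
  have fdt := fd t; rewrite /psi /bondH; apply: is_derive_eq.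
  rewrite /dpsi /GRing.scale/=; ring.
have dpsiE t : expR (2 * t) * dpsi t = expR (2 * t) * df t - 2 * l.
  rewrite /dpsi mulrBr; congr (_ - _).
  have -> : expR (2 * t) * (l * (2 * expR (- (2 * t)))) =
    2 * l * (expR (2 * t) * expR (- (2 * t))) by ring.
  by rewrite -expRD subrr expR0 mulr1.
have psi0 : psi 0 = f 0 by rewrite /psi bondH0 mulr0 subr0.
have psik' : psi k' = f 0.
  by rewrite /psi /l divfK ?gt_eqF// subKr.
suff : psi k <= f 0.
  rewrite /psi lerBlDl -lerBlDr /l mulrAC.
  by rewrite ler_pdivlMr// => ->.
rewrite leNgt; apply/negP => psik.
have [c1] := MVT k_gt0 (fun x _ => psid x) (@is_derive_continuous _ _ _ psid).
rewrite in_itv/= psi0 subr0 => /andP[c10 c1k] psi1.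
have [c2] := MVT kk' (fun x _ => psid x) (@is_derive_continuous _ _ _ psid).
rewrite in_itv/= psik' => /andP[kc2 c2k'] psi2.
have c1p : 0 < expR (2 * c1) * dpsi c1.
  rewrite mulr_gt0 ?expR_gt0//.
  by have : 0 < dpsi c1 * k by [rewrite -psi1 subr_gt0]; rewrite pmulr_lgt0.
have c2n : expR (2 * c2) * dpsi c2 < 0.
  rewrite pmulr_rlt0 ?expR_gt0//.
  have : dpsi c2 * (k' - k) < 0 by rewrite -psi2 subr_lt0.
  by rewrite pmulr_llt0// subr_gt0.
have := dfmono c1 c2 (ltW c10) (ltW (lt_trans c1k kc2)).
move: c1p c2n; rewrite !dpsiE; lra.
Qed.

Context d (T : measurableType d) (P : probability T R).

Lemma is_derive_expect_expR (g c : T -> R) (k : R) : bmeas g -> bmeas c ->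
  is_derive k 1 (fun k => \int[P]_x (g x * expR (k * c x)))
    (\int[P]_x (g x * c x * expR (k * c x))).
Proof.
move=> bg bc; have [_ [B gB]] := bg; have [_ [C cC]] := bc.
pose f k x := g x * expR (k * c x).
have fd (l : R) x : is_derive l 1 (f ^~ x) (g x * c x * expR (l * c x)).
  by rewrite /f; apply: is_derive_eq; rewrite /GRing.scale/=; ring.
have d1f l x : partial1of2 f l x = g x * c x * expR (l * c x).
  by rewrite partial1of2E; apply: derive_val.
have bf l : bmeas (f l).
  by apply: bmeasM => //; apply: bmeas_expR; exact: bmeasZ.
have B0 : 0 <= B by rewrite (le_trans _ (gB point))//.
have C0 : 0 <= C by rewrite (le_trans _ (cC point))//.
have ki : [set` `]k - 1, k + 1[%R] k.
  by rewrite /= in_itv/= ltrBlDr !ltrDl ltr01.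
have iI l : [set` `]k - 1, k + 1[%R] l -> P.-integrable setT (EFin \o f l).
  by move=> _; exact: bmeas_integrable.
have dI l x : [set` `]k - 1, k + 1[%R] l -> [set: T] x -> derivable (f ^~ x) l 1.
  by move=> _ _; have [] := fd l x.
pose G := fun _ : T => B * C * expR ((`|k| + 1) * C).
have G0 x : 0 <= G x by rewrite /G !mulr_ge0// expR_ge0.
have iG : P.-integrable setT (EFin \o G) by exact/bmeas_integrable/bmeas_cst.
have Gub l x : [set` `]k - 1, k + 1[%R] l -> [set: T] x ->
    `|partial1of2 f l x| <= G x.
  rewrite /= in_itv/= => /andP[l1 l2] _; rewrite d1f 2!normrM.
  rewrite [X in _ * X]ger0_norm ?expR_ge0//.
  rewrite ler_pM ?mulr_ge0 ?expR_ge0// ?ler_pM//.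
  rewrite ler_expR (le_trans (ler_norm _))// normrM ler_pM//.
  by rewrite ler_norml; have := ler_norm k; have := ler_norm (- k); rewrite normrN; lra.
have dU := derivable_under_integral measurableT ki iI dI G0 iG Gub.
have eU := differentiation_under_integral measurableT ki iI dI G0 iG Gub.
apply: DeriveDef; first exact: dU.
rewrite -derive1E eU; apply: eq_Rintegral => x _; exact: d1f.
Qed.

(** F is the observable, c the cosine carried by the bond, and w the weight of all
    other bonds.  The hypotheses cov1 and cov2 are, up to the factor Z^2, the
    nonnegativity of the truncated correlations of F with c and c^2. *)
Section tilted.
Variables (F c w : T -> R).
Hypotheses (bF : bmeas F) (bc : bmeas c) (bw : bmeas w).
Hypothesis c_le1 : forall x, c x <= 1.
Hypothesis w_gt0 : exists2 e : R, 0 < e & forall x, e <= w x.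

Let wt k x := w x * expR (k * c x).
Let N i k := \int[P]_x (F x * c x ^+ i * wt k x).
Let Z i k := \int[P]_x (c x ^+ i * wt k x).

Hypothesis cov1 : forall k : R, 0 <= k -> 0 <= N 1 k * Z 0 k - N 0 k * Z 1 k.
Hypothesis cov2 : forall k : R, 0 <= k -> 0 <= N 2 k * Z 0 k - N 0 k * Z 2 k.

Let bwt k : bmeas (wt k).
Proof. by apply: bmeasM => //; apply: bmeas_expR; exact: bmeasZ. Qed.

Let dN i (k : R) : is_derive k 1 (N i) (N i.+1 k).
Proof.
have := is_derive_expect_expR k (bmeasM (bmeasM bF (bmeasX i bc)) bw) bc.
rewrite /N /wt.
under [in X in _ -> X]eq_fun do under eq_Rintegral do rewrite mulrA.
by under [in X in _ -> X]eq_Rintegral do rewrite exprSr mulrA mulrA (mulrAC _ (c _) (w _)).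
Qed.

Let dZ i (k : R) : is_derive k 1 (Z i) (Z i.+1 k).
Proof.
have := is_derive_expect_expR k (bmeasM (bmeasX i bc) bw) bc.
rewrite /Z /wt.
under [in X in _ -> X]eq_fun do under eq_Rintegral do rewrite mulrA.
by under [in X in _ -> X]eq_Rintegral do rewrite exprSr mulrA (mulrAC _ (c _) (w _)).
Qed.

Let Z0_gt0 k : 0 < Z 0 k.
Proof.
have [e e0 ew] := w_gt0; have [_ [C cC]] := bc.
apply: expect_gt0; first by apply: bmeasM => //; exact: bmeasX.
exists (e * expR (- (`|k| * C))); first by rewrite mulr_gt0 ?expR_gt0.
move=> x; rewrite expr0 mul1r ler_pM ?expR_ge0 ?(ltW e0)//.
rewrite ler_expR lerNl (le_trans (ler_norm _))// normrN normrM.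
by rewrite ler_wpM2l.
Qed.

Let Z1_le k : Z 1 k <= Z 0 k.
Proof.
have [e e0 ew] := w_gt0.
apply: le_expect => [||x]; try by apply: bmeasM => //; exact: bmeasX.
rewrite expr1 expr0 ler_wpM2r// /wt mulr_ge0 ?expR_ge0//.
by rewrite (le_trans _ (ew x))// ltW.
Qed.

Let D1 k := N 1 k * Z 0 k - N 0 k * Z 1 k.
Let D2 k := N 2 k * Z 0 k - N 0 k * Z 2 k.

(** With f = N_0 / Z_0, the derivative of exp(2k) f'(k) is
    exp(2k) / Z_0^3 (D_2 Z_0 + 2 D_1 (Z_0 - Z_1)), where D_i = N_i Z_0 - N_0 Z_i;
    the last factor is nonnegative because c <= 1. *)
Lemma tilted_bond_response : bond_response (fun k => N 0 k / Z 0 k).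
Proof.
pose df k := D1 k / Z 0 k ^+ 2.
have Zn0 k : Z 0 k != 0 by rewrite gt_eqF.
apply: (@bond_response_derive _ df) => [k|k k0|].
- have dn := dN 0 k; have dz := dZ 0 k.
  have dzi := is_deriveV (Zn0 k).
  apply: is_derive_eq; rewrite /GRing.scale/= /df /D1; field.
  exact: Zn0.
- by rewrite divr_ge0 ?cov1// exprn_ge0// ltW.
- move=> k k' k0; rewrite le_eqVlt => /predU1P[->//|kk'].
  pose f2 k := expR (2 * k) * df k.
  pose df2 k := expR (2 * k) / Z 0 k ^+ 3 *
    (D2 k * Z 0 k + 2 * D1 k * (Z 0 k - Z 1 k)).
  have df2P (x : R) : is_derive x 1 f2 (df2 x).
    have dn0 := dN 0 x; have dz0 := dZ 0 x; have dn1 := dN 1 x; have dz1 := dZ 1 x.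
    have dzi := is_deriveV (Zn0 x).
    have -> : f2 = (fun k => expR (2 * k) * (N 1 k * Z 0 k - N 0 k * Z 1 k)
                * ((Z 0 k)^-1 * (Z 0 k)^-1)).
      by apply/funext => y; rewrite /f2 /df /D1; field; exact: Zn0.
    apply: is_derive_eq; rewrite /GRing.scale/= /df2 /D1 /D2; field.
    exact: Zn0.
  have [c0] := MVT kk' (fun x _ => df2P x) (@is_derive_continuous _ _ _ df2P).
  rewrite in_itv/= => /andP[kc _] E; rewrite -subr_ge0 -/(f2 k') -/(f2 k) E.
  have c00 : 0 <= c0 by rewrite (le_trans k0)// ltW.
  rewrite mulr_ge0 ?subr_ge0 ?(ltW kk')// /df2 mulr_ge0//.
    by rewrite divr_ge0 ?expR_ge0// exprn_ge0// ltW.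
  apply: addr_ge0; first by apply: mulr_ge0; [exact: cov2|exact: ltW].
  by apply: mulr_ge0; [apply: mulr_ge0 => //; exact: cov1|rewrite subr_ge0].
Qed.

End tilted.
End single_bond_calculus.

(** * Shifts and doublings of the circle *)

Section circle.
Context {R : realType}.
Local Notation leb := (@lebesgue_measure R).

Section affine.
Variables (a c : R).
Hypothesis a_gt0 : 0 < a.

Let aff (x : measurableTypeR R) : measurableTypeR R := a * x + c.

Let maff : measurable_fun setT aff.
Proof. by apply: measurable_funD => //; apply: measurable_funM. Qed.

Let push : {measure set (measurableTypeR R) -> \bar R} :=
  measure_function_pushforward__canonical__measure_function_Measure leb maff.

(** Both measures give the same mass to the intervals ]x, y]. *)
Lemma lebesgue_affine (A : set (measurableTypeR R)) : measurable A ->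
  leb A = (a%:E * leb (aff @^-1` A))%E.
Proof.
move=> mA; pose k : {nonneg R} := NngNum (ltW a_gt0).
transitivity (mscale k push A); last by [].
apply: lebesgue_measure_unique => // X [[x y] _ <-] /=.
rewrite /mscale /= /pushforward.
have -> : aff @^-1` `]x, y] = `](x - c) / a, (y - c) / a]%classic.
  apply/seteqP; split => t /=; rewrite /aff !in_itv/=;
  by rewrite ltr_pdivrMr// ler_pdivlMr// ltrBlDr lerBrDr (mulrC t).
rewrite !lebesgue_measure_itv/= !lte_fin ltr_pM2r ?invr_gt0// ltrD2r.
case: ifP => _; last by rewrite mule0.
rewrite -!EFinB -EFinM; congr EFin; field; rewrite gt_eqF//.
Qed.

Lemma ge0_integral_affine (h : measurableTypeR R -> \bar R) (u v : R) :
  measurable_fun setT h -> (forall x, 0 <= h x)%E ->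
  (\int[leb]_(x in `](a * u + c)%R, (a * v + c)%R]) h x =
   a%:E * \int[leb]_(x in `]u, v]) h (a * x + c)%R)%E.
Proof.
move=> mh h0; pose k : {nonneg R} := NngNum (ltW a_gt0).
rewrite (eq_measure_integral (mscale k push)); last first.
  by move=> A mA _; exact: lebesgue_affine.
rewrite ge0_integral_mscale//; last exact: measurable_funTS.
rewrite ge0_integral_pushforward//; last exact: measurable_funTS.
congr (_ * integral _ _ _)%E.
apply/seteqP; split => t /=; rewrite /aff !in_itv/=;
by rewrite ltrD2r ltr_pM2l// lerD2r ler_pM2l.
Qed.

End affine.

Local Notation tau := (2 * pi : R).

Section periodic.
Variable h : measurableTypeR R -> \bar R.
Hypothesis mh : measurable_fun setT h.
Hypothesis h_ge0 : forall x, (0 <= h x)%E.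
Hypothesis h_per : forall x, h (x + tau) = h x.

Let I u v := (\int[leb]_(x in `]u, v]) h x)%E.

Let I_cat u v w : u <= v -> v <= w -> I u w = (I u v + I v w)%E.
Proof.
move=> uv vw; rewrite /I (@itv_bndbnd_setU _ _ _ (BRight v))//.
rewrite ge0_integral_setU//; first exact: measurable_funTS.
apply/disj_setPS => x [/=]; rewrite !in_itv/= => /andP[_ xv] /andP[vx _].
by move: (lt_le_trans vx xv); rewrite ltxx.
Qed.

Let I_shift u v : I (u + tau) (v + tau) = I u v.
Proof.
rewrite /I; have := @ge0_integral_affine 1 tau ltr01 h u v mh h_ge0.
rewrite !mul1r mul1e => ->; apply: eq_integral => x _.
by rewrite mul1r h_per.
Qed.

Lemma periodic_nat n x : h (x + tau *+ n) = h x.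
Proof. by elim: n x => [|n IHn] x; rewrite ?mulr0n ?addr0// mulrS addrA IHn h_per. Qed.

Lemma periodic_int (z : int) x : h (x + tau *~ z) = h x.
Proof.
case: (intP z) => [|n|n]; first by rewrite mulr0z addr0.
  by rewrite -pmulrn periodic_nat.
by rewrite mulrNz -pmulrn -[LHS](periodic_nat n.+1) subrK.
Qed.

Let I_period c : 0 <= c <= tau -> I c (c + tau) = I 0 tau.
Proof.
move=> /andP[c0 c1].
have t0 : 0 <= tau by rewrite (le_trans c0).
rewrite (I_cat c1) ?lerDr// -[X in I X (c + _)]add0r I_shift addeC.
by rewrite -I_cat.
Qed.

(** After removing whole turns from c one may take 0 <= c <= tau, and then the
    part of ]c, c + tau] beyond tau can be moved back by one period. *)
Lemma integral_periodic_shift c :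
  (\int[leb]_(x in `]0%R, tau]) h (x + c)%R = \int[leb]_(x in `]0%R, tau]) h x)%E.
Proof.
have tau0 : 0 < tau := two_pi_gt0 R.
pose z := Num.floor (c / tau); pose c0 := c - tau *~ z.
have cE : c = c0 + tau *~ z by rewrite subrK.
have c0tau : 0 <= c0 <= tau.
  have := floor_itv (c / tau); rewrite -/z => /andP[z1 z2].
  move: z1 z2; rewrite ler_pdivlMr// ltr_pdivrMr// intrD /c0 -[tau *~ z]mulrzl.
  by move: (z%:~R) (2 * pi) => w t ? ?; apply/andP; split; lra.
have hE x : h (x + c) = h (1 * x + c0) by rewrite mul1r cE addrA periodic_int.
under eq_integral => x _ do rewrite hE.
have := @ge0_integral_affine 1 c0 ltr01 h 0 tau mh h_ge0.
rewrite mul1e !mul1r add0r.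
by move=> <-; rewrite addrC; exact: I_period.
Qed.

Lemma integral_periodic_double :
  (\int[leb]_(x in `]0%R, tau]) h (2 * x)%R = \int[leb]_(x in `]0%R, tau]) h x)%E.
Proof.
have tau0 : 0 < tau := two_pi_gt0 R.
have := @ge0_integral_affine 2 0 (ltr0n R 2) h 0 tau mh h_ge0.
rewrite mulr0 !addr0.
under [in X in _ = X -> _]eq_integral do rewrite addr0.
have -> : 2 * tau = tau + tau by rewrite mulr2n mulrDl mul1r.
rewrite -/(I 0 (tau + tau)) (@I_cat _ tau)// ?lerDl ?(ltW tau0)//.
rewrite -[X in I X (_ + _)]add0r I_shift => E.
have : ((2^-1)%:E * (I 0%R tau + I 0%R tau) = (2^-1)%:E * (2%:E *
  \int[leb]_(x in `]0%R, tau]) h (2 * x)%R))%E by rewrite E.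
rewrite -mule2n -mule_natl !muleA -!EFinM mulVf ?pnatr_eq0// !mul1e.
exact: esym.
Qed.

End periodic.

Lemma expect_circle_ge0 (f : R -> R) : bmeas (f : measurableTypeR R -> R) ->
  (forall x, 0 <= f x) ->
  \int[circle_law R]_x f x = fine ((tau^-1)%:E * \int[leb]_(x in `]0%R, tau]) (f x)%:E)%E.
Proof.
move=> [mf _] f0; congr fine.
have mfE : measurable_fun setT (EFin \o f) by exact/measurable_EFinP.
rewrite integral_uniform// subr0; congr (_ * _)%E.
by rewrite integral_itv_obnd_cbnd//; exact: measurable_funTS.
Qed.

(** A bounded function becomes nonnegative after adding a constant, which both
    sides of a claimed equality of means feel in the same way. *)
Lemma expect_add_cst_inj d1 d2 (T1 : measurableType d1) (T2 : measurableType d2)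
    (P1 : probability T1 R) (P2 : probability T2 R) (f : T1 -> R) (g : T2 -> R)
    (B : R) :
  bmeas f -> bmeas g ->
  \int[P1]_x (f x + B) = \int[P2]_x (g x + B) -> \int[P1]_x f x = \int[P2]_x g x.
Proof.
move=> bf bg; rewrite !expectD//; try exact: bmeas_cst.
by rewrite !expect_cst => /addIr.
Qed.

Lemma expect_circle_shift (f : R -> R) c : bmeas (f : measurableTypeR R -> R) ->
  (forall x, f (x + tau) = f x) ->
  \int[circle_law R]_x f (x + c) = \int[circle_law R]_x f x.
Proof.
move=> bf fper; have [_ [B fB]] := bf.
have ms : measurable_fun setT (fun x : measurableTypeR R => x + c : measurableTypeR R).
  exact: measurable_funD.
have bfc := bmeas_comp bf ms.
have bB : bmeas (fun x : measurableTypeR R => f x + B).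
  by apply: bmeasD => //; exact: bmeas_cst.
apply: (@expect_add_cst_inj _ _ _ _ _ _ _ _ B) => //.
have f0 x : 0 <= f x + B.
  by have := fB x; rewrite ler_norml -lerBlDr sub0r => /andP[].
rewrite !expect_circle_ge0//; last exact: (bmeas_comp bB ms).
congr (fine (_ * _)%E).
apply: (@integral_periodic_shift (fun x => (f x + B)%:E)) => //.
- by apply/measurable_EFinP; case: bB.
- by move=> x; rewrite fper.
Qed.

Lemma expect_circle_double (f : R -> R) : bmeas (f : measurableTypeR R -> R) ->
  (forall x, f (x + tau) = f x) ->
  \int[circle_law R]_x f (2 * x) = \int[circle_law R]_x f x.
Proof.
move=> bf fper; have [_ [B fB]] := bf.
have ms : measurable_fun setT (fun x : measurableTypeR R => 2 * x : measurableTypeR R).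
  exact: measurable_funM.
have bfc := bmeas_comp bf ms.
have bB : bmeas (fun x : measurableTypeR R => f x + B).
  by apply: bmeasD => //; exact: bmeas_cst.
apply: (@expect_add_cst_inj _ _ _ _ _ _ _ _ B) => //.
have f0 x : 0 <= f x + B.
  by have := fB x; rewrite ler_norml -lerBlDr sub0r => /andP[].
rewrite !expect_circle_ge0//; last exact: (bmeas_comp bB ms).
congr (fine (_ * _)%E).
apply: (@integral_periodic_double (fun x => (f x + B)%:E)) => //.
- by apply/measurable_EFinP; case: bB.
- by move=> x; rewrite fper.
Qed.

End circle.

(** * Duplication of the torus *)

Section duplication.
Context {R : realType}.
Local Notation tau := (2 * pi : R).
Local Notation RR := (measurableTypeR R).

Lemma expect_swap23 d1 d2 d3 d4 (T1 : measurableType d1) (T2 : measurableType d2)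
    (T3 : measurableType d3) (T4 : measurableType d4)
    (P1 : probability T1 R) (P2 : probability T2 R)
    (P3 : probability T3 R) (P4 : probability T4 R)
    (H : (T1 * T2) * (T3 * T4) -> R) : bmeas H ->
  \int[P1]_a \int[P2]_b \int[P3]_c \int[P4]_d H ((a, b), (c, d)) =
  \int[P1]_a \int[P3]_c \int[P2]_b \int[P4]_d H ((a, b), (c, d)).
Proof.
move=> bH; apply: eq_Rintegral => a _.
apply: (@fubini_expect _ _ _ _ _ P2 P3 (fun z => \int[P4]_d H ((a, z.1), (z.2, d)))).
apply: (@bmeas_expect _ _ _ _ _ P4 (fun z => H ((a, z.1.1), (z.1.2, z.2)))).
apply: (bmeas_comp bH); apply: measurable_fun_pair; apply: measurable_fun_pair => //;
  by apply: measurableT_comp.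
Qed.

(** The substitution (s, t) -> (s + t, s - t) preserves the Haar measure of the
    two-torus although it is two-to-one: a shift in the first variable turns it
    into (s, t) -> (s + 2t, s), and doubling preserves the mean on the circle. *)
Lemma circle_duplication (K : RR * RR -> R) : bmeas K ->
  (forall s t, K (s + tau, t) = K (s, t)) ->
  (forall s t, K (s, t + tau) = K (s, t)) ->
  \int[circle_law R]_s \int[circle_law R]_t K (s, t) =
  \int[circle_law R]_s \int[circle_law R]_t K (s + t, s - t).
Proof.
move=> bK per1 per2; set C := circle_law R.
have mD : measurable_fun setT (fun z : RR * RR => z.1 + z.2 : RR).
  exact: measurable_funD.
have mB : measurable_fun setT (fun z : RR * RR => z.1 - z.2 : RR).
  exact: measurable_funB.
have mM : measurable_fun setT (fun z : RR * RR => z.1 + 2 * z.2 : RR).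
  by apply: measurable_funD => //; exact: measurable_funM.
have bK1 : bmeas (fun z : RR * RR => K (z.1 + z.2, z.1 - z.2)).
  by apply: (bmeas_comp bK); exact: measurable_fun_pair.
have bK2 : bmeas (fun z : RR * RR => K (z.1 + 2 * z.2, z.1)).
  by apply: (bmeas_comp bK); exact: measurable_fun_pair.
apply: (etrans _ (esym (fubini_expect C C bK1))).
transitivity (\int[C]_t \int[C]_s K (s + 2 * t, s)); last first.
  apply: eq_Rintegral => t _.
  rewrite -(@expect_circle_shift _ (fun s : RR => K (s + 2 * t, s)) (- t)).
  - by apply: eq_Rintegral => s _ /=; congr (K (_, _)); ring.
  - exact: (bmeas_section2 t bK2).
  - by move=> s; rewrite per2 addrAC per1.
apply: (etrans _ (fubini_expect C C bK2)).
apply: (etrans (fubini_expect C C bK)).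
apply: eq_Rintegral => s _.
rewrite -(@expect_circle_shift _ (fun t : RR => K (t, s)) s)//; last first.
  exact: (bmeas_section2 s bK).
rewrite -expect_circle_double; first by apply: eq_Rintegral => t _; rewrite addrC.
- apply: (bmeas_comp bK); apply: measurable_fun_pair => //.
  exact: measurable_funD.
- by move=> t; rewrite addrAC per1.
Qed.

Definition tuple_add n (a b : n.-tuple RR) : n.-tuple RR :=
  [tuple tnth a i + tnth b i | i < n].
Definition tuple_sub n (a b : n.-tuple RR) : n.-tuple RR :=
  [tuple tnth a i - tnth b i | i < n].

Lemma measurable_tuple_add d (T : measurableType d) n (f g : T -> n.-tuple RR) :
  measurable_fun setT f -> measurable_fun setT g ->
  measurable_fun setT (fun x => tuple_add (f x) (g x)).
Proof.
move=> /measurable_fun_tnthP mf /measurable_fun_tnthP mg.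
apply/measurable_fun_tnthP => i.
rewrite [X in measurable_fun _ X](_ : _ = fun x => tnth (f x) i + tnth (g x) i).
  by apply: measurable_funD; [exact: (mf i)|exact: (mg i)].
by apply/funext => x /=; rewrite tnth_mktuple.
Qed.

Lemma measurable_tuple_sub d (T : measurableType d) n (f g : T -> n.-tuple RR) :
  measurable_fun setT f -> measurable_fun setT g ->
  measurable_fun setT (fun x => tuple_sub (f x) (g x)).
Proof.
move=> /measurable_fun_tnthP mf /measurable_fun_tnthP mg.
apply/measurable_fun_tnthP => i.
rewrite [X in measurable_fun _ X](_ : _ = fun x => tnth (f x) i - tnth (g x) i).
  by apply: measurable_funB; [exact: (mf i)|exact: (mg i)].
by apply/funext => x /=; rewrite tnth_mktuple.
Qed.

Local Notation tcons := (fun x t => Defs.cons_tuple (x, t)).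

Lemma measurable_tcons d (T : measurableType d) n (f : T -> RR) (g : T -> n.-tuple RR) :
  measurable_fun setT f -> measurable_fun setT g ->
  measurable_fun setT (fun x => tcons (f x) (g x)).
Proof.
move=> mf mg; apply: (measurableT_comp (@Defs.measurable_cons_tuple _ _ n)).
exact: measurable_fun_pair.
Qed.

Lemma tuple_add_cons n x y (a b : n.-tuple RR) :
  tuple_add (tcons x a) (tcons y b) = tcons (x + y) (tuple_add a b).
Proof.
apply: eq_from_tnth => i; rewrite tnth_mktuple.
by case: (unliftP ord0 i) => [j ->|->]; rewrite ?tnthS ?tnth0 ?tnth_mktuple.
Qed.

Lemma tuple_sub_cons n x y (a b : n.-tuple RR) :
  tuple_sub (tcons x a) (tcons y b) = tcons (x - y) (tuple_sub a b).
Proof.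
apply: eq_from_tnth => i; rewrite tnth_mktuple.
by case: (unliftP ord0 i) => [j ->|->]; rewrite ?tnthS ?tnth0 ?tnth_mktuple.
Qed.

(** Periodicity in all the coordinates is expressed through this relation because
    it is compatible with adjoining a coordinate. *)
Definition turned n (a b : n.-tuple RR) :=
  forall i, tnth b i = tnth a i \/ tnth b i = tnth a i + tau.

Lemma turned_refl n (a : n.-tuple RR) : turned a a.
Proof. by move=> i; left. Qed.

Lemma turned_cons n x y (a b : n.-tuple RR) : y = x \/ y = x + tau -> turned a b ->
  turned (tcons x a) (tcons y b).
Proof.
by move=> xy ab i; case: (unliftP ord0 i) => [j ->|->]; rewrite ?tnthS ?tnth0.
Qed.

(** Coordinates are treated one at a time: Fubini's theorem brings the first
    coordinates of both configurations together, where [circle_duplication]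
    applies. *)
Lemma torus_duplication n (G : n.-tuple RR * n.-tuple RR -> R) : bmeas G ->
  (forall a b c, turned a b -> G (b, c) = G (a, c)) ->
  (forall a b c, turned a b -> G (c, b) = G (c, a)) ->
  let P := pprod (circle_law R) n in
  \int[P]_a \int[P]_b G (a, b) = \int[P]_a \int[P]_b G (tuple_add a b, tuple_sub a b).
Proof.
elim: n G => [|n IHn] G bG per1 per2.
  apply: eq_Rintegral => a _; apply: eq_Rintegral => b _.
  by congr (G (_, _)); rewrite tuple0 [RHS]tuple0.
set Q := pprod (circle_law R) n; set C := circle_law R.
move=> P.
have unfold2 (H : n.+1.-tuple RR * n.+1.-tuple RR -> R) : bmeas H ->
    \int[P]_a \int[P]_b H (a, b) =
    \int[C]_x \int[Q]_a \int[C]_y \int[Q]_b H (tcons x a, tcons y b).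
  move=> bH; rewrite expect_pprodS; last exact: bmeas_expect.
  apply: eq_Rintegral => x _; apply: eq_Rintegral => a _.
  by rewrite expect_pprodS//; exact: bmeas_section1.
have bH : bmeas (fun z : (RR * n.-tuple RR) * (RR * n.-tuple RR) =>
    G (tcons z.1.1 z.1.2, tcons z.2.1 z.2.2)).
  apply: (bmeas_comp bG); apply: measurable_fun_pair;
  by apply: measurable_tcons; exact: measurableT_comp.
have bH' : bmeas (fun z : (RR * n.-tuple RR) * (RR * n.-tuple RR) =>
    G (tcons (z.1.1 + z.2.1) (tuple_add z.1.2 z.2.2),
       tcons (z.1.1 - z.2.1) (tuple_sub z.1.2 z.2.2))).
  apply: (bmeas_comp bG); apply: measurable_fun_pair; apply: measurable_tcons.
  - by apply: measurable_funD; exact: measurableT_comp.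
  - by apply: measurable_tuple_add; exact: measurableT_comp.
  - by apply: measurable_funB; exact: measurableT_comp.
  - by apply: measurable_tuple_sub; exact: measurableT_comp.
rewrite unfold2// (unfold2 (fun z => G (tuple_add z.1 z.2, tuple_sub z.1 z.2))); last first.
  apply: (bmeas_comp bG).
  by apply: measurable_fun_pair; [apply: measurable_tuple_add|apply: measurable_tuple_sub].
apply: (etrans (expect_swap23 C Q C Q bH)).
transitivity (\int[C]_x \int[Q]_a \int[C]_y \int[Q]_b
    G (tcons (x + y) (tuple_add a b), tcons (x - y) (tuple_sub a b))); last first.
  apply: eq_Rintegral => x _; apply: eq_Rintegral => a _.
  apply: eq_Rintegral => y _; apply: eq_Rintegral => b _.
  by rewrite -tuple_add_cons -tuple_sub_cons.
apply: (etrans _ (esym (expect_swap23 C Q C Q bH'))).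
pose K (z : RR * RR) := \int[Q]_a \int[Q]_b G (tcons z.1 (tuple_add a b), tcons z.2 (tuple_sub a b)).
transitivity (\int[C]_x \int[C]_y K (x, y)).
  apply: eq_Rintegral => x _; apply: eq_Rintegral => y _ /=.
  apply: (IHn (fun z => G (tcons x z.1, tcons y z.2))).
  - apply: (bmeas_comp bG); apply: measurable_fun_pair; apply: measurable_tcons => //.
  - move=> a b c ab; apply: per1; apply: turned_cons => //; by left.
  - move=> a b c ab; apply: per2; apply: turned_cons => //; by left.
have bK : bmeas K.
  apply: (@bmeas_expect _ _ _ _ _ Q (fun z => \int[Q]_b
    G (tcons z.1.1 (tuple_add z.2 b), tcons z.1.2 (tuple_sub z.2 b)))).
  apply: (@bmeas_expect _ _ _ _ _ Q (fun z =>
    G (tcons z.1.1.1 (tuple_add z.1.2 z.2), tcons z.1.1.2 (tuple_sub z.1.2 z.2)))).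
  apply: (bmeas_comp bG); apply: measurable_fun_pair; apply: measurable_tcons.
  + by do 2 apply: measurableT_comp => //.
  + by apply: measurable_tuple_add => //; exact: measurableT_comp.
  + by do 2 apply: measurableT_comp => //.
  + by apply: measurable_tuple_sub => //; exact: measurableT_comp.
have K1 s t : K (s + tau, t) = K (s, t).
  apply: eq_Rintegral => a _; apply: eq_Rintegral => b _ /=.
  apply: per1; apply: turned_cons; [by right|exact: turned_refl].
have K2 s t : K (s, t + tau) = K (s, t).
  apply: eq_Rintegral => a _; apply: eq_Rintegral => b _ /=.
  apply: per2; apply: turned_cons; [by right|exact: turned_refl].
exact: (circle_duplication bK K1 K2).
Qed.

End duplication.

(** * Positive kernels *)

Section positive_kernels.
Context {R : realType} d (T : measurableType d).
Implicit Types k l : T -> T -> R.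

(** Such a kernel has a nonnegative double integral against P x P for every
    probability P, and products of such kernels are again of this form, which
    fails for the property of having a nonnegative double integral. *)
Definition split_kernel k := exists (I : finType) (Phi : I -> T -> R),
  (forall i, bmeas (Phi i)) /\ forall x y, k x y = \sum_i Phi i x * Phi i y.

Lemma split_kernel_rank1 (c : R) (phi : T -> R) : 0 <= c -> bmeas phi ->
  split_kernel (fun x y => c * (phi x * phi y)).
Proof.
move=> c0 bphi; exists unit, (fun _ x => Num.sqrt c * phi x).
split => [_|x y]; first exact: bmeasZ.
rewrite (bigD1 tt)//= big1 ?addr0; last by case.
by rewrite mulrACA -expr2 sqr_sqrtr.
Qed.

Lemma split_kernel_cst (c : R) : 0 <= c -> split_kernel (fun _ _ => c).
Proof.
move=> c0; have [I [Phi [bP E]]] := split_kernel_rank1 c0 (bmeas_cst T 1).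
by exists I, Phi; split => // x y; rewrite -E !mulr1.
Qed.

Lemma split_kernelD k l : split_kernel k -> split_kernel l ->
  split_kernel (fun x y => k x y + l x y).
Proof.
move=> [I [F [bF kE]]] [J [G [bG lE]]].
exists (I + J)%type, (fun z x => match z with inl i => F i x | inr j => G j x end).
split => [[i|j]|x y]; [exact: bF|exact: bG|].
by rewrite big_sumType/= kE lE.
Qed.

Lemma split_kernelM k l : split_kernel k -> split_kernel l ->
  split_kernel (fun x y => k x y * l x y).
Proof.
move=> [I [F [bF kE]]] [J [G [bG lE]]].
exists (I * J)%type, (fun z x => F z.1 x * G z.2 x).
split => [z|x y]; first exact: bmeasM.
rewrite kE lE big_distrlr/= pair_bigA/=; apply: eq_bigr => z _.
by rewrite mulrACA.
Qed.

Lemma split_kernelX k n : split_kernel k -> split_kernel (fun x y => k x y ^+ n).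
Proof.
move=> sk; elim: n => [|n IHn]; first exact: split_kernel_cst.
by under eq_fun do under eq_fun do rewrite exprS; exact: split_kernelM.
Qed.

Lemma split_kernel_sum (I : Type) (r : seq I) (F : I -> T -> T -> R) :
  (forall i, split_kernel (F i)) ->
  split_kernel (fun x y => \sum_(i <- r) F i x y).
Proof.
move=> sF; elim: r => [|i r IHr].
  by under eq_fun do under eq_fun do rewrite big_nil; exact: split_kernel_cst.
by under eq_fun do under eq_fun do rewrite big_cons; exact: split_kernelD.
Qed.

Lemma bmeas_split_kernel k : split_kernel k -> bmeas (fun z : T * T => k z.1 z.2).
Proof.
move=> [I [F [bF kE]]]; under eq_fun do rewrite kE.
apply: bmeas_sum => i _; apply: bmeasM; apply: (bmeas_comp (bF i)) => //.
Qed.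

Lemma split_kernel_ge0 (P : probability T R) k : split_kernel k ->
  0 <= \int[P]_x \int[P]_y k x y.
Proof.
move=> [I [F [bF kE]]].
have inner x : \int[P]_y k x y = \sum_i F i x * \int[P]_y F i y.
  under eq_Rintegral => y _ do rewrite kE.
  rewrite expect_sum => [|i]; last exact: bmeasZ.
  by apply: eq_bigr => i _; rewrite expectZ.
have -> : \int[P]_x \int[P]_y k x y = \sum_i (\int[P]_x F i x) ^+ 2.
  under eq_Rintegral => x _ do rewrite inner.
  rewrite expect_sum => [|i]; last by apply: bmeasM => //; exact: bmeas_cst.
  by apply: eq_bigr => i _; rewrite expr2 expectZr.
by apply: sumr_ge0 => i _; exact: sqr_ge0.
Qed.

(** The error bound is the tail of the series at B, which dominates termwise the
    tail at any s with |s| <= B. *)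
Lemma exp_partial_sum_dist (B : R) : 0 <= B ->
  exists2 e : nat -> R, e n @[n --> \oo] --> 0 &
  forall s n, `|s| <= B -> `|expR s - \sum_(i < n) s ^+ i / i`!%:R| <= e n.
Proof.
move=> B0; exists (fun n => expR B - series (exp_coeff B) n).
  rewrite -[X in _ --> X](subrr (expR B)); apply: cvgB; first exact: cvg_cst.
  exact: is_cvg_series_exp_coeff.
move=> s n sB.
have -> : \sum_(i < n) s ^+ i / i`!%:R = series (exp_coeff s) n.
  by rewrite /series/= big_mkord.
have c1 : `|series (exp_coeff s) m - series (exp_coeff s) n| @[m --> \oo] -->
    `|expR s - series (exp_coeff s) n|.
  apply: cvg_norm; apply: cvgB; last exact: cvg_cst.
  exact: is_cvg_series_exp_coeff.
have c2 : series (exp_coeff B) m - series (exp_coeff B) n @[m --> \oo] -->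
    expR B - series (exp_coeff B) n.
  by apply: cvgB; [exact: is_cvg_series_exp_coeff|exact: cvg_cst].
rewrite -(cvg_lim _ c1)// -[leRHS](cvg_lim _ c2)//.
apply: ler_lim; [by apply/cvg_ex; eexists; exact: c1|by apply/cvg_ex; eexists; exact: c2|].
near=> m.
have nm : (n <= m)%N by near: m; exact: nbhs_infty_ge.
rewrite !sub_series_geq// (le_trans (ler_norm_sum _ _ _))//.
apply: ler_sum => i _; rewrite /exp_coeff/= normrM normrX [X in _ * X]ger0_norm ?invr_ge0//.
by rewrite ler_wpM2r ?invr_ge0// lerXn2r ?nnegrE.
Unshelve. all: by end_near. Qed.

(** Replacing the exponential by its Taylor polynomials leaves a kernel that
    splits, and the error is uniformly small. *)
Lemma split_kernel_exp_ge0 (P : probability T R) k l :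
  split_kernel k -> split_kernel l ->
  0 <= \int[P]_x \int[P]_y (k x y * expR (l x y)).
Proof.
move=> sk sl.
have bk := bmeas_split_kernel sk; have bl := bmeas_split_kernel sl.
have [_ [B lB]] := bl; have [_ [D kD]] := bk.
have B0 : 0 <= B by rewrite (le_trans _ (lB (point, point))).
have D0 : 0 <= D by rewrite (le_trans _ (kD (point, point))).
have [e e0 eP] := exp_partial_sum_dist B0.
pose S n x y := \sum_(i < n) l x y ^+ i / i`!%:R.
have sS n : split_kernel (S n).
  apply: split_kernel_sum => i; apply: split_kernelM; first exact: split_kernelX.
  by apply: split_kernel_cst; rewrite invr_ge0.
have bS n := bmeas_split_kernel (sS n).
set J := \int[P]_x _.
have main n : - (D * e n) <= J.
  have := split_kernel_ge0 P (split_kernelM sk (sS n)).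
  set J' := \int[P]_x _ => J'0.
  suff : `|J - J'| <= D * e n.
    by rewrite ler_norml => /andP[+ _]; move: J'0; lra.
  pose f (z : T * T) := k z.1 z.2 * expR (l z.1 z.2).
  pose g (z : T * T) := k z.1 z.2 * S n z.1 z.2.
  have bf : bmeas f by apply: bmeasM => //; exact: bmeas_expR.
  have bg : bmeas g by apply: bmeasM => //; exact: bS.
  have -> : J = \int[(P \x P)%E]_z f z by rewrite expect_prod.
  have -> : J' = \int[(P \x P)%E]_z g z by rewrite expect_prod.
  rewrite -expectB//; apply: expect_abs_le; first exact: bmeasB.
  move=> z; rewrite /f /g -mulrBr normrM ler_pM//.
  by apply: eP; exact: lB.
have c : - (D * e n) @[n --> \oo] --> 0.
  rewrite -[X in _ --> X]oppr0; apply: cvgN.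
  by rewrite -[X in _ --> X](mulr0 D); apply: cvgM => //; exact: cvg_cst.
rewrite -(cvg_lim _ c)//; apply: limr_le; last by apply: nearW.
by apply/cvg_ex; exists 0.
Qed.

End positive_kernels.

(** * Ginibre's inequality *)

Section density.
Context {R : realType} d (T : measurableType d) (P nu : probability T R).

(** The density g and the Radon-Nikodym derivative of nu have the same integral
    over every measurable set, so they agree almost everywhere. *)
Lemma expect_density (g f : T -> R) : bmeas g -> bmeas f ->
  (forall A, measurable A -> nu A = (\int[P]_(x in A) (g x)%:E)%E) ->
  \int[nu]_x f x = \int[P]_x (f x * g x).
Proof.
move=> bg bf nuE; congr fine.
have numu : nu `<< P.
  apply/null_content_dominatesP => A mA PA0; apply: etrans (nuE A mA) _.
  apply: null_set_integral => //; apply: measurable_funTS.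
  by apply/measurable_EFinP; case: bg.
have ifn : nu.-integrable setT (EFin \o f) by exact: bmeas_integrable.
rewrite -(Radon_Nikodym_change_of_variables numu measurableT ifn).
apply: ae_eq_integral => //.
- apply: emeasurable_funM; first by apply/measurable_EFinP; case: bf.
  exact: (measurable_int _ (Radon_Nikodym_integrable _)).
- by apply/measurable_EFinP; case: (bmeasM bf bg).
- under [X in ae_eq _ _ _ X]eq_fun do rewrite EFinM.
  apply: ae_eqe_mul2l; apply: integral_ae_eq => //.
  + exact: Radon_Nikodym_integrable.
  + by apply/measurable_EFinP; case: bg.
  + by move=> E _ mE; rewrite -Radon_Nikodym_integral//= -nuE.
Qed.

End density.

Section ginibre.
Context {R : realType}.
Local Notation RR := (measurableTypeR R).
Variable n : nat.
Local Notation config := (n.-tuple RR).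
Local Notation P := (pprod (circle_law R) n).

(** Functions on the torus, as functions of the representing angles. *)
Definition torus_fun (B : config -> R) :=
  bmeas B /\ forall a b, turned a b -> B b = B a.

(** Duplication turns differences of these observables into splitting kernels;
    for a cosine, cos(a - b) - cos(a + b) = 2 sin(a) sin(b). *)
Definition ginibre_obs (B : config -> R) := torus_fun B /\
  exists r : config -> config -> R, split_kernel r /\
  forall a b, B (tuple_sub a b) - B (tuple_add a b) = r a b.

(** For a Gibbs weight, cos(a + b) + cos(a - b) = 2 cos(a) cos(b) in the exponent. *)
Definition ginibre_weight (w : config -> R) := torus_fun w /\
  exists l : config -> config -> R, split_kernel l /\
  forall a b, w (tuple_add a b) * w (tuple_sub a b) = expR (l a b).

(** The left-hand side is half the mean of (F' - F)(B' - B) w w' over two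
    independent copies; after duplication the integrand is a splitting kernel times
    the exponential of a splitting kernel. *)
Lemma ginibre (F B w : config -> R) :
  ginibre_obs F -> ginibre_obs B -> ginibre_weight w ->
  0 <= (\int[P]_t (F t * B t * w t)) * (\int[P]_t w t) -
       (\int[P]_t (F t * w t)) * (\int[P]_t (B t * w t)).
Proof.
move=> [[bF pF] [rF [sF FE]]] [[bB pB] [rB [sB BE]]] [[bw pw] [l [sl wE]]].
pose G (z : config * config) :=
  (F z.2 - F z.1) * (B z.2 - B z.1) * (w z.1 * w z.2).
have b1 (f : config -> R) : bmeas f -> bmeas (fun z : config * config => f z.1).
  by move=> bf; exact: bmeas_comp.
have b2 (f : config -> R) : bmeas f -> bmeas (fun z : config * config => f z.2).
  by move=> bf; exact: bmeas_comp.
have bG : bmeas G.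
  apply: bmeasM; first by apply: bmeasM; apply: bmeasB; auto.
  by apply: bmeasM; auto.
have G_ge0 : 0 <= \int[P]_a \int[P]_b G (a, b).
  rewrite (torus_duplication bG); first last.
  - by move=> a b c ab; rewrite /G/= (pF _ _ ab) (pB _ _ ab) (pw _ _ ab).
  - by move=> a b c ab; rewrite /G/= (pF _ _ ab) (pB _ _ ab) (pw _ _ ab).
  have := split_kernel_exp_ge0 P (split_kernelM sF sB) sl.
  congr (_ <= _); apply: eq_Rintegral => a _; apply: eq_Rintegral => b _.
  by rewrite /G/= FE BE wE.
have prodE (f g : config -> R) : bmeas f -> bmeas g ->
    \int[(P \x P)%E]_z (f z.1 * g z.2) = (\int[P]_t f t) * (\int[P]_t g t).
  move=> bf bg; rewrite expect_prod; last by apply: bmeasM; auto.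
  under eq_Rintegral => x _ do rewrite /= expectZ//.
  by rewrite expectZr.
pose FBw t := F t * B t * w t; pose Fw t := F t * w t; pose Bw t := B t * w t.
have bFBw : bmeas FBw by apply: bmeasM => //; exact: bmeasM.
have bFw : bmeas Fw by apply: bmeasM.
have bBw : bmeas Bw by apply: bmeasM.
have GE : \int[P]_a \int[P]_b G (a, b) = 2 *
    ((\int[P]_t FBw t) * (\int[P]_t w t) - (\int[P]_t Fw t) * (\int[P]_t Bw t)).
  rewrite -expect_prod//.
  have -> : G = fun z => (FBw z.1 * w z.2 + w z.1 * FBw z.2)
                       - (Fw z.1 * Bw z.2 + Bw z.1 * Fw z.2).
    by apply/funext => z; rewrite /G /FBw /Fw /Bw; ring.
  rewrite expectB ?expectD; last 6 first;
    try by [apply: bmeasM; auto|apply: bmeasD; apply: bmeasM; auto].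
  by rewrite !prodE//; ring.
by move: G_ge0; rewrite GE pmulr_rge0// ltr0n.
Qed.

End ginibre.

(** * Correlations of the XY model *)

Section xy_observables.
Context {R : realType} (V : finType).
Local Notation RR := (measurableTypeR R).
Local Notation config := (#|V|.-tuple RR).
Local Notation tau := (2 * pi : R).

Definition angle_diff (u v : V) (t : config) : R := angle t u - angle t v.

Lemma angle_diff_add u v a b :
  angle_diff u v (tuple_add a b) = angle_diff u v a + angle_diff u v b.
Proof. by rewrite /angle_diff /angle !tnth_mktuple; ring. Qed.

Lemma angle_diff_sub u v a b :
  angle_diff u v (tuple_sub a b) = angle_diff u v a - angle_diff u v b.
Proof. by rewrite /angle_diff /angle !tnth_mktuple; ring. Qed.

Lemma measurable_angle_diff u v : measurable_fun setT (angle_diff u v).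
Proof. by apply: measurable_funB; exact: measurable_angle. Qed.

Lemma cos_turn (x : R) : cos (x + tau) = cos x.
Proof. by rewrite mulr_natl cosD2pi. Qed.

Lemma torus_cos u v : torus_fun (fun t => cos (angle_diff u v t)).
Proof.
split; first by apply: bmeas_cos; exact: measurable_angle_diff.
move=> a b ab; rewrite /angle_diff /angle.
have [->|->] := ab (enum_rank u); have [->|->] := ab (enum_rank v) => //.
- by rewrite -cos_turn; congr cos; ring.
- by rewrite addrAC cos_turn.
- by congr cos; ring.
Qed.

Let ssin u v : split_kernel (fun a b : config =>
  2 * (sin (angle_diff u v a) * sin (angle_diff u v b))).
Proof.
by apply: split_kernel_rank1 => //; apply: bmeas_sin; exact: measurable_angle_diff.
Qed.

Let scos u v (c : R) : 0 <= c -> split_kernel (fun a b : config =>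
  c * (cos (angle_diff u v a) * cos (angle_diff u v b))).
Proof.
by move=> c0; apply: split_kernel_rank1 => //; apply: bmeas_cos; exact: measurable_angle_diff.
Qed.

Lemma ginibre_cos u v : ginibre_obs (fun t => cos (angle_diff u v t)).
Proof.
split; first exact: torus_cos.
eexists; split; first exact: (ssin u v).
by move=> a b /=; rewrite angle_diff_add angle_diff_sub cosB cosD; ring.
Qed.

(** The difference of squares has the extra factor
    cos(a - b) + cos(a + b) = 2 cos(a) cos(b). *)
Lemma ginibre_cos2 u v : ginibre_obs (fun t => cos (angle_diff u v t) ^+ 2).
Proof.
split.
  have [bc pc] := torus_cos u v; split; first exact: (bmeasX 2 bc).
  by move=> a b ab; rewrite (pc _ _ ab).
eexists; split; first exact: (split_kernelM (ssin u v) (scos u v (ler0n R 2))).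
by move=> a b /=; rewrite angle_diff_add angle_diff_sub cosB cosD; ring.
Qed.

Variables (E : finType) (ends : E -> V * V).

Lemma bmeas_xy_weight (K : E -> R) : bmeas (xy_weight ends K).
Proof.
apply: bmeas_expR; apply: bmeas_sum => e _; apply: bmeasZ.
apply: bmeas_cos; exact: (measurable_angle_diff (ends e).1 (ends e).2).
Qed.

Lemma ginibre_xy_weight (K : E -> R) : (forall e, 0 <= K e) ->
  ginibre_weight (xy_weight ends K).
Proof.
move=> K0; split.
  split; first exact: bmeas_xy_weight.
  move=> a b ab; rewrite /xy_weight; congr expR; apply: eq_bigr => e _.
  by have [_ /(_ _ _ ab)] := torus_cos (ends e).1 (ends e).2 => ->.
pose l (e : E) (a b : config) := (2 * K e) *
  (cos (angle_diff (ends e).1 (ends e).2 a) * cos (angle_diff (ends e).1 (ends e).2 b)).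
exists (fun a b => \sum_(e : E) l e a b); split.
  by apply: split_kernel_sum => e; apply: scos; rewrite mulr_ge0.
move=> a b; rewrite -expRD -big_split/=; congr expR; apply: eq_bigr => e _.
rewrite -/(angle_diff _ _ (tuple_add a b)) -/(angle_diff _ _ (tuple_sub a b)).
by rewrite angle_diff_add angle_diff_sub cosB cosD /l; ring.
Qed.

Lemma xy_weight_ge (K : E -> R) :
  exists2 e : R, 0 < e & forall t, e <= xy_weight ends K t.
Proof.
exists (expR (- \sum_(e : E) `|K e|)); first exact: expR_gt0.
move=> t; rewrite ler_expR -sumrN; apply: ler_sum => e _.
rewrite lerNl (le_trans (ler_norm _))// normrN normrM ler_piMr//.
by rewrite ler_norml cos_geN1 cos_le1.
Qed.

Lemma xy_Z_gt0 (K : E -> R) : 0 < xy_Z ends K.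
Proof. by apply: expect_gt0; [exact: bmeas_xy_weight|exact: xy_weight_ge]. Qed.

Lemma xy_gibbs_setT (K : E -> R) : xy_gibbs ends K setT = 1%E.
Proof.
have bw := bmeasZ (xy_Z ends K)^-1 (bmeas_xy_weight K).
rewrite /xy_gibbs -(EFin_expect (free_measure R V) bw).
rewrite expectZ; last exact: bmeas_xy_weight.
by rewrite mulVf// gt_eqF// xy_Z_gt0.
Qed.

HB.instance Definition _ (K : E -> R) :=
  Measure_isProbability.Build _ _ _ (xy_gibbs ends K) (xy_gibbs_setT K).

Lemma xy_corrE (K : E -> R) x y : xy_corr ends K x y =
  (\int[free_measure R V]_t (cos (angle_diff x y t) * xy_weight ends K t)) / xy_Z ends K.
Proof.
have bw := bmeas_xy_weight K; have [bc _] := torus_cos x y.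
have bZw := bmeasZ (xy_Z ends K)^-1 bw.
apply: etrans (@expect_density _ _ _ (free_measure R V) (xy_gibbs ends K) _ _ bZw bc _) _.
  by move=> A mA.
under eq_Rintegral do rewrite mulrCA.
by rewrite expectZ; [rewrite mulrC|exact: bmeasM].
Qed.

Lemma xy_corr_norm_le1 (K : E -> R) x y : `|xy_corr ends K x y| <= 1.
Proof.
have [bc _] := torus_cos x y.
apply: (@expect_abs_le _ _ _ (xy_gibbs ends K) _ 1 bc) => t.
by rewrite ler_norml cos_geN1 cos_le1.
Qed.

Definition set_bond (K : E -> R) (e : E) (k : R) : E -> R :=
  fun e' => if e' == e then k else K e'.

Lemma bond_response_xy_corr (K : E -> R) e x y : (forall e, 0 <= K e) ->
  bond_response (fun k => xy_corr ends (set_bond K e k) x y).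
Proof.
move=> K0.
pose c t := cos (angle_diff (ends e).1 (ends e).2 t).
pose F t := cos (angle_diff x y t).
pose w := xy_weight ends (set_bond K e 0).
have [bF _] : torus_fun F := torus_cos x y.
have [bc _] : torus_fun c := torus_cos (ends e).1 (ends e).2.
have bw : bmeas w := bmeas_xy_weight _.
have wE k t : xy_weight ends (set_bond K e k) t = w t * expR (k * c t).
  rewrite /w /xy_weight -expRD; congr expR.
  rewrite (bigD1 e)//= [in RHS](bigD1 e)//= /set_bond eqxx mul0r add0r addrC.
  congr (_ + _); apply: eq_bigr => e' /negbTE e'e.
  by rewrite e'e.
have gw k : 0 <= k -> ginibre_weight (fun t => w t * expR (k * c t)).
  move=> k0; have : ginibre_weight (xy_weight ends (set_bond K e k)).
    by apply: ginibre_xy_weight => e'; rewrite /set_bond; case: ifP.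
  by congr ginibre_weight; apply/funext => t; rewrite wE.
have cov (i : nat) k : 0 <= k -> ginibre_obs (fun t => c t ^+ i) ->
  0 <= (\int[free_measure R V]_t (F t * c t ^+ i * (w t * expR (k * c t)))) *
       (\int[free_measure R V]_t (c t ^+ 0 * (w t * expR (k * c t)))) -
       (\int[free_measure R V]_t (F t * c t ^+ 0 * (w t * expR (k * c t)))) *
       (\int[free_measure R V]_t (c t ^+ i * (w t * expR (k * c t)))).
  move=> k0 gc; have := ginibre (ginibre_cos x y) gc (gw k k0).
  congr (0 <= _ * _ - _ * _); apply: eq_Rintegral => t _; rewrite expr0 ?mulr1 ?mul1r//.
have gc1 : ginibre_obs (fun t => c t ^+ 1) := ginibre_cos _ _.
have gc2 : ginibre_obs (fun t => c t ^+ 2) := ginibre_cos2 _ _.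
have c1 t : c t <= 1 by exact: cos_le1.
have := tilted_bond_response bF bc bw c1 (xy_weight_ge _)
  (fun k k0 => cov 1%N k k0 gc1) (fun k k0 => cov 2%N k k0 gc2).
congr bond_response; apply/funext => k; rewrite xy_corrE.
congr (_ / _); apply: eq_Rintegral => t _; rewrite wE expr0 ?mulr1 ?mul1r//.
Qed.

End xy_observables.

(** * Measurability, and total variation as a bound on means *)

Section xy_corr_measurable.
Context {R : realType} (V E : finType) (ends : E -> V * V).

Lemma bmeas_xy_corr_bounded d (T : measurableType d) (K : T -> E -> R) x y :
  (forall e, bmeas (K ^~ e)) -> bmeas (fun t => xy_corr ends (K t) x y).
Proof.
move=> bK; split; last by exists 1 => t; exact: xy_corr_norm_le1.
pose P := free_measure R V.
have bw : bmeas (fun z : T * _ => xy_weight ends (K z.1) z.2).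
  apply: bmeas_expR; apply: bmeas_sum => e _; apply: bmeasM.
    exact: (bmeas_comp (bK e)).
  apply: bmeas_cos.
  exact: (measurableT_comp (measurable_angle_diff (ends e).1 (ends e).2)).
have bcw : bmeas (fun z : T * _ => cos (angle_diff x y z.2) * xy_weight ends (K z.1) z.2).
  apply: bmeasM => //; apply: bmeas_cos.
  exact: (measurableT_comp (measurable_angle_diff x y)).
have [mN _] := bmeas_expect P bcw; have [mZ _] := bmeas_expect P bw.
rewrite [X in measurable_fun _ X](_ : _ = fun t =>
  (\int[P]_s (cos (angle_diff x y s) * xy_weight ends (K t) s)) *
  expR (- ln (\int[P]_s xy_weight ends (K t) s))); last first.
  apply/funext => t; rewrite xy_corrE expRN lnK// posrE.
  exact: xy_Z_gt0.
apply: measurable_funM => //; apply: measurableT_comp => //.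
by apply: measurableT_comp => //; apply: measurableT_comp => //; exact: measurable_ln.
Qed.

(** Unbounded couplings are reached as limits of truncated ones. *)
Lemma bmeas_xy_corr d (T : measurableType d) (K : T -> E -> R) x y :
  (forall e, measurable_fun setT (K ^~ e)) -> bmeas (fun t => xy_corr ends (K t) x y).
Proof.
move=> mK; split; last by exists 1 => t; exact: xy_corr_norm_le1.
pose cap (N : nat) t e := Num.max (- N%:R) (Num.min (K t e) N%:R).
apply: (@measurable_fun_cvg _ _ _ _ (fun N t => xy_corr ends (cap N t) x y)).
  move=> N; suff [] : bmeas (fun t => xy_corr ends (cap N t) x y) by [].
  apply: bmeas_xy_corr_bounded => e; split.
    by apply: measurable_maxr => //; apply: measurable_minr.
  exists N%:R => t; rewrite /cap ler_norml le_max lexx/= ge_max.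
  by rewrite ge_min lexx orbT andbT (le_trans _ (ler0n R N))// oppr_le0.
move=> t _; apply: cvg_near_cst.
have [N0 HN0] : exists N0 : nat, forall e, `|K t e| <= N0%:R.
  exists (Num.bound (\sum_(e : E) `|K t e|)) => e.
  apply: le_trans (ltW (archi_boundP _)); last by apply: sumr_ge0.
  by rewrite (bigD1 e)//= lerDl sumr_ge0.
near=> N; congr (xy_corr ends _ x y); apply/funext => e; rewrite /cap.
have : `|K t e| <= N%:R.
  by rewrite (le_trans (HN0 e))// ler_nat; near: N; exact: nbhs_infty_ge.
by rewrite ler_norml => /andP[l u]; rewrite min_l// max_r.
Unshelve. all: by end_near. Qed.

End xy_corr_measurable.

Section total_variation.
Context {R : realType}.
Implicit Types P Q : law R.

Lemma tv_dist_ub P Q A : measurable A -> `|fine (P A) - fine (Q A)| <= tv_dist P Q.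
Proof.
move=> mA; apply: sup_ubound; last by exists A.
exists 1 => _ [B mB <-].
have fin (S : law R) : 0 <= fine (S B) <= 1.
  have fS : (S B \is a fin_num)%E by exact: fin_num_measure.
  by rewrite -!lee_fin (fineK fS) measure_ge0 probability_le1.
by rewrite ler_norml; have := fin P; have := fin Q; lra.
Qed.

Lemma tv_dist_ge0 P Q : 0 <= tv_dist P Q.
Proof. by rewrite (le_trans _ (tv_dist_ub P Q measurable0)). Qed.

Lemma tv_distC P Q : tv_dist P Q = tv_dist Q P.
Proof.
rewrite /tv_dist; congr sup; apply/seteqP; split => _ [A mA <-];
by exists A => //; rewrite distrC.
Qed.

(** The sum counts the integers in ]0, y], so that it is the integer part of y. *)
Lemma count_thresholds (y : R) n : 0 <= y <= n%:R ->
  \sum_(k < n) (k.+1%:R <= y)%R%:R <= y <= \sum_(k < n) (k.+1%:R <= y)%R%:R + 1.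
Proof.
pose S m := \sum_(k < m) ((k.+1%:R <= y)%R%:R : R).
have S_le m : S m <= m%:R.
  rewrite /S (le_trans (ler_sum (G := fun=> 1) _ _))//.
    by move=> i _; rewrite lern1 leq_b1.
  by rewrite sumr_const card_ord.
have S_eq m : m%:R <= y -> S m = m%:R.
  move=> my; rewrite /S (eq_bigr (fun=> 1)) ?sumr_const ?card_ord// => i _.
  by rewrite (le_trans _ my)// ler_nat.
move=> /andP[y0]; rewrite -/(S n).
elim: n => [|n IHn] yn.
  by rewrite /S big_ord0; apply/andP; split; lra.
have SS : S n.+1 = S n + (n.+1%:R <= y)%R%:R by rewrite /S big_ord_recr.
have [ny|yn'] := leP n.+1%:R y.
  by rewrite S_eq// ny/=; lra.
rewrite SS (lt_geF yn') addr0.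
have [ny|/ltW yn''] := leP n%:R y.
  rewrite S_eq// ny/=.
  by move: yn; rewrite -natr1.
exact: IHn.
Qed.

(** Up to L / n, the function h is the average of L times the indicators of its level
    sets, and the masses of a level set under the two laws differ by at most the
    total variation distance. *)
Lemma expect_tv P Q (h : measurableTypeR R -> R) (L : R) : bmeas h ->
  (forall x, 0 <= h x <= L) ->
  \int[Q]_x h x <= \int[P]_x h x + L * tv_dist P Q.
Proof.
move=> bh hL; set dl := tv_dist P Q.
have L0 : 0 <= L by have /andP[a b] := hL point; exact: le_trans b.
have [L_eq0|Ln0] := eqVneq L 0.
  have h0 x : h x = 0 by apply/eqP; rewrite eq_le andbC -{2}L_eq0; exact: hL.
  under eq_Rintegral do rewrite h0.
  by under [in leRHS]eq_Rintegral do rewrite h0; rewrite !expect_cst L_eq0; lra.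
have {Ln0}L_gt0 : 0 < L by rewrite lt_neqAle eq_sym Ln0.
suff main (n : nat) : \int[Q]_x h x <= \int[P]_x h x + L * dl + L / n.+1%:R.
  rewrite leNgt; apply/negP => lt.
  set D := \int[Q]_x h x - (\int[P]_x h x + L * dl).
  have D0 : 0 < D by rewrite subr_gt0.
  have := main (Num.bound (L / D)).
  have : L / (Num.bound (L / D)).+1%:R < D.
    rewrite ltr_pdivrMr// mulrC -ltr_pdivrMr//.
    rewrite (lt_trans (archi_boundP _))// ?divr_ge0// 1?ltW//.
    by rewrite ltr_nat.
  by rewrite ltrBrDl => a /(lt_le_trans a); rewrite ltxx.
pose A (k : nat) := [set x | k.+1%:R <= h x * (n.+1%:R / L)].
have mA k : measurable (A k).
  have mf : measurable_fun setT (fun x : measurableTypeR R => h x * (n.+1%:R / L)).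
    by apply: measurable_funM => //; case: bh.
  have := mf measurableT `[k.+1%:R, +oo[%classic (measurable_itv _).
  rewrite setTI; congr measurable; apply/seteqP; split => x /=;
    by rewrite in_itv/= andbT.
pose S x := \sum_(k < n.+1) \1_(A k) x : R.
have bS : bmeas S by apply: bmeas_sum => k _; exact: bmeas_indic.
have hS x : L / n.+1%:R * S x <= h x <= L / n.+1%:R * (S x + 1).
  have y0n : 0 <= h x * (n.+1%:R / L) <= n.+1%:R.
    have /andP[h0 hl] := hL x; rewrite mulr_ge0// ?divr_ge0//=.
    by rewrite mulrCA ler_piMr// ler_pdivrMr// mul1r.
  have := count_thresholds y0n.
  have -> : \sum_(k < n.+1) (k.+1%:R <= h x * (n.+1%:R / L))%R%:R = S x.
    apply: eq_bigr => k _; rewrite indicE; congr (_%:R); congr nat_of_bool.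
    by apply/idP/idP; rewrite inE.
  have -> : h x * (n.+1%:R / L) = h x / (L / n.+1%:R) by rewrite invf_div.
  by rewrite ler_pdivlMr ?ler_pdivrMr ?divr_gt0// !(mulrC (_ / _)).
have SE (W : law R) : \int[W]_x S x = \sum_(k < n.+1) fine (W (A k)).
  rewrite /S expect_sum => [|k]; last exact: bmeas_indic.
  by apply: eq_bigr => k _; rewrite expect_indic.
have c0 : 0 <= L / n.+1%:R by rewrite divr_ge0.
have bLS : bmeas (fun x => L / n.+1%:R * S x) by exact: bmeasZ.
have bS1 : bmeas (fun x => S x + 1) by apply: bmeasD => //; exact: bmeas_cst.
have up : \int[Q]_x h x <= L / n.+1%:R * (\int[Q]_x S x + 1).
  rewrite (le_trans (le_expect Q bh (bmeasZ _ bS1) (fun x => proj2 (andP (hS x)))))//.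
  by rewrite expectZ// expectD ?expect_cst//; exact: bmeas_cst.
have lo : L / n.+1%:R * \int[P]_x S x <= \int[P]_x h x.
  by rewrite -expectZ//; apply: le_expect => // x; have /andP[] := hS x.
have SPQ : \int[Q]_x S x <= \int[P]_x S x + n.+1%:R * dl.
  have -> : n.+1%:R * dl = \sum_(k < n.+1) dl.
    by rewrite sumr_const card_ord mulr_natl.
  rewrite !SE -big_split/=.
  apply: ler_sum => k _; have := tv_dist_ub P Q (mA k).
  by rewrite ler_norml -/dl; lra.
apply: (le_trans up); rewrite mulrDr mulr1 lerD2r.
apply: (le_trans (ler_wpM2l c0 SPQ)); rewrite mulrDr; apply: lerD => //.
by rewrite mulrA divfK.
Qed.

End total_variation.

(** * Comparison of two bond laws, one bond after the other *)

Section comparison.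
Context {R : realType}.
Local Notation RR := (measurableTypeR R).
Local Notation tcons := (fun x t => Defs.cons_tuple (x, t)).

(** Under a law on [0, M] clamping changes nothing almost surely; it makes the
    bounds 0 <= j <= M hold at every point, so that no exceptional sets occur in the
    iterated integrals. *)
Definition clamp (M j : R) : R := Num.max 0 (Num.min j M).

Lemma clamp_ge0 M j : 0 <= clamp M j.
Proof. by rewrite /clamp le_max lexx. Qed.

Lemma clamp_le M j : 0 <= M -> clamp M j <= M.
Proof. by move=> M0; rewrite /clamp ge_max M0 ge_min lexx orbT. Qed.

Lemma clamp_id M j : 0 <= j <= M -> clamp M j = j.
Proof. by move=> /andP[j0 jM]; rewrite /clamp min_l// max_r. Qed.

Lemma clamp_ge M m j : m <= j -> m <= M -> m <= clamp M j.
Proof. by move=> mj mM; rewrite /clamp le_max le_min mj mM orbT. Qed.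

Lemma measurable_clamp M : measurable_fun setT (clamp M : RR -> RR).
Proof. by apply: measurable_maxr => //; exact: measurable_minr. Qed.

Section one_bond.
Variables (P Q : law R) (S : set RR) (m M b b' : R).
Hypotheses (mS : measurable S) (Sm : forall j, S j -> m <= j).
Hypotheses (m_ge0 : 0 <= m) (mM : m <= M).
Hypotheses (b_ge0 : 0 <= b) (bb' : b <= b').
Hypothesis PS_gt0 : 0 < fine (P S).
Hypothesis gain : (fine (P S) + tv_dist P Q) * bondH (b * M) <=
                  fine (P S) * bondH (b' * m).

(** Let h be phi at inverse temperature b, raised to its largest value phi(bM) on S
    and lowered by the constant phi(0).  Apart from that constant, h dominates the
    integrand on the left, its means under P and Q differ by at most
    d (phi(bM) - phi(0)), and on S the integrand on the right exceeds it by at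
    least phi(b'm) - phi(bM).  The hypothesis on H says, through the response
    property of phi, that this gain outweighs the loss. *)
Lemma one_bond_comparison (phi : R -> R) : bond_response phi ->
  bmeas (fun j : RR => phi (b * clamp M j)) ->
  bmeas (fun j : RR => phi (b' * clamp M j)) ->
  \int[Q]_j phi (b * clamp M j) <= \int[P]_j phi (b' * clamp M j).
Proof.
move=> [phi_mono phi_ratio] bphi bphi'.
have M0 : 0 <= M by exact: le_trans mM.
have b'0 : 0 <= b' by exact: le_trans bb'.
move: PS_gt0 gain => p_gt0 gain0.
set p := fine (P S) in p_gt0 gain0 *; set dl := tv_dist P Q in gain0 *.
have dl0 : 0 <= dl := tv_dist_ge0 P Q.
set K := b * M in gain0 *; set K' := b' * m in gain0 *.
have K0 : 0 <= K by exact: mulr_ge0.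
have K'0 : 0 <= K' by exact: mulr_ge0.
have KK' : K <= K'.
  rewrite -bondH_mono -(ler_pM2l p_gt0) (le_trans _ gain0)//.
  by rewrite ler_wpM2r ?bondH_ge0// lerDl.
pose L := phi K - phi 0; pose L' := phi K' - phi 0.
have L0 : 0 <= L by rewrite subr_ge0 phi_mono.
have gainL : (p + dl) * L <= p * L'.
  have [K_eq0|Kn0] := eqVneq K 0.
    rewrite {1}/L K_eq0 subrr mulr0 mulr_ge0 ?(ltW p_gt0)//.
    by rewrite subr_ge0 phi_mono.
  have HK0 : 0 < bondH K by rewrite bondH_gt0 lt_neqAle eq_sym Kn0.
  rewrite -(ler_pM2r HK0) mulrAC.
  have : (p + dl) * bondH K * L <= p * bondH K' * L by rewrite ler_wpM2r.
  move=> /le_trans; apply.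
  by rewrite -!mulrA ler_wpM2l ?(ltW p_gt0)// mulrC; exact: phi_ratio.
pose c j := clamp M j.
have cM j : b * c j <= K by rewrite ler_wpM2l// clamp_le.
have bc0 j : 0 <= b * c j by rewrite mulr_ge0// clamp_ge0.
pose h (j : RR) := phi (b * c j) - phi 0 + \1_S j * (phi K - phi (b * c j)).
have bS : bmeas (fun j : RR => \1_S j : R) by exact: bmeas_indic.
have bh : bmeas h.
  apply: bmeasD; first by apply: bmeasB => //; exact: bmeas_cst.
  by apply: bmeasM => //; apply: bmeasB => //; exact: bmeas_cst.
have hL x : 0 <= h x <= L.
  rewrite /h /L indicE.
  have := phi_mono _ _ (bc0 x) (cM x); have := phi_mono _ _ (lexx 0) (bc0 x).
  by case: (x \in S) => /=; rewrite ?mul1r ?mul0r => ? ?; apply/andP; split; lra.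
have up : \int[Q]_j phi (b * clamp M j) <= phi 0 + \int[Q]_j h j.
  rewrite -[X in X + _](expect_cst Q) -expectD//; last exact: bmeas_cst.
  apply: le_expect => // [|j]; first by apply: bmeasD => //; exact: bmeas_cst.
  rewrite /h indicE; have := phi_mono _ _ (bc0 j) (cM j); rewrite /c.
  by case: (j \in S) => /=; rewrite ?mul1r ?mul0r; lra.
have lo : phi 0 + \int[P]_j h j + p * (phi K' - phi K) <=
    \int[P]_j phi (b' * clamp M j).
  rewrite -[X in X + _ + _](expect_cst P) -expectD//; last exact: bmeas_cst.
  rewrite /p -(expect_indic P mS) -expectZr// -expectD//; last 2 first.
  - by apply: bmeasD => //; exact: bmeas_cst.
  - by apply: bmeasM => //; exact: bmeas_cst.
  apply: le_expect => // [|j].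
    apply: bmeasD; first by apply: bmeasD => //; exact: bmeas_cst.
    by apply: bmeasM => //; exact: bmeas_cst.
  rewrite /h indicE.
  have mono1 := phi_mono _ _ (bc0 j) (ler_wpM2r (clamp_ge0 M j) bb').
  case: (boolP (j \in S)) => /= jS; rewrite ?mul1r ?mul0r; last by rewrite /c; lra.
  have mj : m <= clamp M j by apply: clamp_ge => //; apply: Sm; rewrite inE in jS.
  have := phi_mono _ _ K'0 (ler_wpM2l b'0 mj); rewrite /c; lra.
have tv := expect_tv P Q bh hL.
apply: (le_trans up); apply: le_trans lo.
move: gainL tv; rewrite -/dl /L /L'; lra.
Qed.

End one_bond.

Definition tset n (K : n.-tuple RR) (i : 'I_n) (k : R) : n.-tuple RR :=
  [tuple if j == i then k else tnth K j | j < n].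

Definition tscale (M b : R) n (J : n.-tuple RR) : n.-tuple RR :=
  [tuple b * clamp M (tnth J i) | i < n].

Lemma tset0 n x y (K : n.-tuple RR) : tset (tcons x K) ord0 y = tcons y K.
Proof.
apply: eq_from_tnth => j; rewrite tnth_mktuple.
by case: (unliftP ord0 j) => [i ->|->]; rewrite ?tnthS ?tnth0 ?eqxx.
Qed.

Lemma tsetS n x k (K : n.-tuple RR) (i : 'I_n) :
  tset (tcons x K) (lift ord0 i) k = tcons x (tset K i k).
Proof.
apply: eq_from_tnth => j; rewrite tnth_mktuple.
by case: (unliftP ord0 j) => [l ->|->]; rewrite ?tnthS ?tnth0 ?tnth_mktuple.
Qed.

Lemma tscale_cons M b n x (J : n.-tuple RR) :
  tscale M b (tcons x J) = tcons (b * clamp M x) (tscale M b J).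
Proof.
apply: eq_from_tnth => i; rewrite tnth_mktuple.
by case: (unliftP ord0 i) => [j ->|->]; rewrite ?tnthS ?tnth0 ?tnth_mktuple.
Qed.

Lemma measurable_tscale M b n : measurable_fun setT (@tscale M b n).
Proof.
apply/measurable_fun_tnthP => i.
rewrite [X in measurable_fun _ X](_ : _ = fun J => b * clamp M (tnth J i)).
  apply: measurable_funM => //.
  by apply: (measurableT_comp (measurable_clamp M)); exact: measurable_tnth.
by apply/funext => x /=; rewrite tnth_mktuple.
Qed.

Lemma measurable_scale M b : measurable_fun setT (fun j : RR => b * clamp M j : RR).
Proof. by apply: measurable_funM => //; exact: measurable_clamp. Qed.

Definition bondwise_response n (Phi : n.-tuple RR -> R) :=
  forall (K : n.-tuple RR) i, (forall j, 0 <= tnth K j) ->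
    bond_response (fun k => Phi (tset K i k)).

Section all_bonds.
Variables (P Q : law R) (S : set RR) (m M b b' : R).
Hypotheses (mS : measurable S) (Sm : forall j, S j -> m <= j).
Hypotheses (m_ge0 : 0 <= m) (mM : m <= M).
Hypotheses (b_ge0 : 0 <= b) (bb' : b <= b').
Hypothesis PS_gt0 : 0 < fine (P S).
Hypothesis gain : (fine (P S) + tv_dist P Q) * bondH (b * M) <=
                  fine (P S) * bondH (b' * m).

(** Hybrid argument: change the law of the later bonds by induction with the first
    one fixed, then change the law of the first bond with the others fixed. *)
Lemma all_bonds_comparison n (Phi : n.-tuple RR -> R) :
  bmeas Phi -> bondwise_response Phi ->
  \int[pprod Q n]_J Phi (tscale M b J) <= \int[pprod P n]_J Phi (tscale M b' J).
Proof.
have b'0 : 0 <= b' by exact: le_trans bb'.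
have bscale k n' (f : n'.-tuple RR -> R) : bmeas f -> bmeas (fun J => f (tscale M k J)).
  by move=> bf; apply: (bmeas_comp bf); exact: measurable_tscale.
elim: n Phi => [|n IHn] Phi bPhi rPhi.
  rewrite !expect_pprod0; try exact: bscale.
  by rewrite (tuple0 (tscale M b _)) (tuple0 (tscale M b' _)).
pose W k k' (z : RR * n.-tuple RR) := Phi (tcons (k * clamp M z.1) (tscale M k' z.2)).
have bW k k' : bmeas (W k k').
  apply: (bmeas_comp bPhi); apply: measurable_tcons.
    exact: (measurableT_comp (measurable_scale M k)).
  by apply: (@measurableT_comp _ _ _ _ _ _ (@tscale M k' n) setT snd) => //;
    exact: measurable_tscale.
have unfoldW (L : law R) k : \int[pprod L n.+1]_J Phi (tscale M k J) =
    \int[L]_j \int[pprod L n]_J W k k (j, J).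
  rewrite expect_pprodS; last exact: bscale.
  by apply: eq_Rintegral => j _; apply: eq_Rintegral => J _; rewrite tscale_cons.
rewrite !unfoldW.
apply: (@le_trans _ _ (\int[Q]_j \int[pprod P n]_J W b b' (j, J))).
  apply: le_expect => [||j]; try exact: bmeas_expect.
  apply: (IHn (fun J => Phi (tcons (b * clamp M j) J))).
    by apply: (bmeas_comp bPhi); exact: measurable_tcons.
  move=> K i K0.
  have -> : (fun k => Phi (tcons (b * clamp M j) (tset K i k))) =
      (fun k => Phi (tset (tcons (b * clamp M j) K) (lift ord0 i) k)).
    by apply/funext => k; rewrite tsetS.
  apply: rPhi => l; case: (unliftP ord0 l) => [l' ->|->]; rewrite ?tnthS// tnth0.
  by rewrite mulr_ge0// clamp_ge0.
rewrite (fubini_expect Q (pprod P n) (bW b b')).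
rewrite [leRHS](fubini_expect P (pprod P n) (bW b' b')).
have bWs L k k' := bmeas_expect L (bmeas_swap (bW k k')).
apply: le_expect => [||J]; [exact: (bWs Q b b')|exact: (bWs P b' b')|].
apply: (@one_bond_comparison P Q S m M b b' _ _ _ _ _ _ _ _
  (fun k => Phi (tcons k (tscale M b' J)))) => //.
- pose z0 : RR := (0 : R).
  have -> : (fun k => Phi (tcons k (tscale M b' J))) =
      (fun k => Phi (tset (tcons z0 (tscale M b' J)) ord0 k)).
    by apply/funext => k; rewrite tset0.
  apply: rPhi => l; case: (unliftP ord0 l) => [l' ->|->]; rewrite ?tnthS ?tnth0//.
  by rewrite tnth_mktuple mulr_ge0// clamp_ge0.
- exact: (bmeas_section2 J (bW b b')).
- exact: (bmeas_section2 J (bW b' b')).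
Qed.

End all_bonds.

Section support.
Variables (M : R) (P : law R).
Hypothesis P_on : law_on M P.

Lemma expect_law_on (f g : RR -> R) : bmeas f -> bmeas g ->
  (forall j, 0 <= j <= M -> f j = g j) -> \int[P]_j f j = \int[P]_j g j.
Proof.
move=> bf bg fg; apply/eqP; rewrite -subr_eq0 -expectB//.
have [_ [B fB]] := bmeasB bf bg.
have B0 : 0 <= B by rewrite (le_trans _ (fB point)).
pose D : set RR := [set` `[0, M]].
have mD : measurable D by exact: measurable_itv.
have bD : bmeas (fun j : RR => \1_(~` D) j : R) by apply: bmeas_indic; exact: measurableC.
have bBD c : bmeas (fun j : RR => c * \1_(~` D) j : R) by exact: (bmeasZ c bD).
have fgB j : `|f j - g j| <= B * \1_(~` D) j.
  rewrite indicE; case: (boolP (j \in ~` D)) => jD; first by rewrite mulr1.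
  rewrite mulr0 fg ?subrr ?normr0//.
  by move: jD; rewrite notin_setE/= => /contrapT; rewrite /D/= in_itv.
have I0 c : \int[P]_j (c * \1_(~` D) j) = 0.
  rewrite expectZ// expect_indic; last exact: measurableC.
  have := probability_setC P mD; rewrite P_on subee// => E.
  by apply/eqP; rewrite mulf_eq0; apply/orP; right; apply/eqP; rewrite E.
rewrite eq_le; apply/andP; split.
  rewrite -(I0 B); apply: le_expect => // [|j]; first exact: bmeasB.
  by have := fgB j; rewrite ler_norml => /andP[].
rewrite -(I0 (- B)); apply: le_expect => // [|j]; first exact: bmeasB.
by rewrite mulNr; have := fgB j; rewrite ler_norml => /andP[].
Qed.

Lemma expect_pprod_clamp n (f : n.-tuple RR -> R) : bmeas f ->
  \int[pprod P n]_J f J = \int[pprod P n]_J f [tuple clamp M (tnth J i) | i < n].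
Proof.
have mcl k : measurable_fun setT (fun J : k.-tuple RR =>
    [tuple clamp M (tnth J i) | i < k] : k.-tuple RR).
  have := @measurable_tscale M 1 k; congr measurable_fun; apply/funext => J.
  by apply: eq_from_tnth => i; rewrite !tnth_mktuple mul1r.
elim: n f => [|n IHn] f bf.
  apply: eq_Rintegral => J _; congr f; by rewrite tuple0 [RHS]tuple0.
rewrite expect_pprodS// expect_pprodS; last exact: (bmeas_comp bf (mcl _)).
have consE j (J : n.-tuple RR) : [tuple clamp M (tnth (tcons j J) i) | i < n.+1] =
    tcons (clamp M j) [tuple clamp M (tnth J i) | i < n].
  apply: eq_from_tnth => i; rewrite tnth_mktuple.
  by case: (unliftP ord0 i) => [l ->|->]; rewrite ?tnthS ?tnth0 ?tnth_mktuple.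
pose W (z : RR * n.-tuple RR) := f (tcons z.1 [tuple clamp M (tnth z.2 i) | i < n]).
have bW : bmeas W.
  apply: (bmeas_comp bf); apply: measurable_tcons => //.
  exact: (measurableT_comp (mcl n)).
have bg := bmeas_expect (pprod P n) bW.
transitivity (\int[P]_j \int[pprod P n]_J W (j, J)).
  apply: eq_Rintegral => j _; apply: (IHn (fun J => f (tcons j J))).
  by apply: (bmeas_comp bf); exact: measurable_tcons.
transitivity (\int[P]_j \int[pprod P n]_J W (clamp M j, J)); last first.
  by apply: eq_Rintegral => j _; apply: eq_Rintegral => J _; rewrite consE.
apply: expect_law_on => //; first exact: (bmeas_comp bg (measurable_clamp M)).
by move=> j jM; rewrite clamp_id.
Qed.

End support.
End comparison.

(** * Marginals and subgraphs *)

Section marginals.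
Context {R : realType}.
Local Notation RR := (measurableTypeR R).
Local Notation tcons := (fun x t => Defs.cons_tuple (x, t)).
Variable P : law R.

Definition tinsert n (i : 'I_n.+1) (x : RR) (J : n.-tuple RR) : n.+1.-tuple RR :=
  [tuple if unlift i k is Some l then tnth J l else x | k < n.+1].

Lemma tnth_tinsert n (i : 'I_n.+1) x (J : n.-tuple RR) : tnth (tinsert i x J) i = x.
Proof. by rewrite tnth_mktuple unlift_none. Qed.

Lemma tnth_tinsert_lift n (i : 'I_n.+1) x (J : n.-tuple RR) l :
  tnth (tinsert i x J) (lift i l) = tnth J l.
Proof. by rewrite tnth_mktuple liftK. Qed.

Lemma measurable_tinsert n (i : 'I_n.+1) d (T : measurableType d)
    (f : T -> RR) (g : T -> n.-tuple RR) :
  measurable_fun setT f -> measurable_fun setT g ->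
  measurable_fun setT (fun x => tinsert i (f x) (g x)).
Proof.
move=> mf /measurable_fun_tnthP mg; apply/measurable_fun_tnthP => k.
case: (unliftP i k) => [l ->|->].
  rewrite [X in measurable_fun _ X](_ : _ = fun x => tnth (g x) l); first exact: (mg l).
  by apply/funext => x /=; rewrite tnth_tinsert_lift.
rewrite [X in measurable_fun _ X](_ : _ = f)//.
by apply/funext => x /=; rewrite tnth_tinsert.
Qed.

(** Independent samples are exchangeable: any one of them may be drawn first. *)
Lemma expect_pprod_pull n (i : 'I_n.+1) (f : n.+1.-tuple RR -> R) : bmeas f ->
  \int[pprod P n.+1]_J f J = \int[P]_x \int[pprod P n]_J f (tinsert i x J).
Proof.
elim: n i f => [|n IHn] i f bf.
  rewrite expect_pprodS//; apply: eq_Rintegral => x _; apply: eq_Rintegral => J _.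
  congr f; apply: eq_from_tnth => k.
  have -> : k = ord0 by exact: ord1.
  have -> : i = ord0 by exact: ord1.
  by rewrite tnth0 tnth_tinsert.
case: (unliftP ord0 i) => [j ->|->]; last first.
  rewrite expect_pprodS//; apply: eq_Rintegral => x _; apply: eq_Rintegral => J _.
  congr f; apply: eq_from_tnth => k.
  by case: (unliftP ord0 k) => [l ->|->]; rewrite ?tnthS ?tnth0 ?tnth_tinsert ?tnth_tinsert_lift.
have consE x y (J : n.-tuple RR) :
    tinsert (lift ord0 j) x (tcons y J) = tcons y (tinsert j x J).
  apply: eq_from_tnth => k; case: (unliftP ord0 k) => [l ->|->]; last first.
    have E0 : ord0 = lift (lift ord0 j) ord0 by apply: val_inj; rewrite /= /bump; lia.
    transitivity (tnth (tinsert (lift ord0 j) x (tcons y J)) (lift (lift ord0 j) ord0)).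
      by rewrite -E0.
    by rewrite tnth_tinsert_lift !tnth0.
  rewrite tnthS; case: (unliftP j l) => [q ->|->]; last by rewrite !tnth_tinsert.
  rewrite tnth_tinsert_lift.
  have -> : lift ord0 (lift j q) = lift (lift ord0 j) (lift ord0 q).
    by apply: val_inj; rewrite /= /bump; lia.
  by rewrite tnth_tinsert_lift tnthS.
rewrite expect_pprodS//.
pose W (z : (RR * RR) * n.-tuple RR) := f (tcons z.1.1 (tinsert j z.1.2 z.2)).
have bW : bmeas W.
  apply: (bmeas_comp bf); apply: measurable_tcons.
    exact: (measurableT_comp measurable_fst).
  apply: measurable_tinsert => //; exact: (measurableT_comp measurable_snd).
transitivity (\int[P]_y \int[P]_x \int[pprod P n]_J W ((y, x), J)).
  apply: eq_Rintegral => y _; apply: (IHn j (fun J => f (tcons y J))).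
  by apply: (bmeas_comp bf); exact: measurable_tcons.
have bWe := bmeas_expect (pprod P n) bW.
apply: (etrans (fubini_expect P P bWe)).
apply: eq_Rintegral => x _; rewrite expect_pprodS; last first.
  by apply: (bmeas_comp bf); exact: measurable_tinsert.
by apply: eq_Rintegral => y _; apply: eq_Rintegral => J _; rewrite consE.
Qed.

Definition tproj n m (s : 'I_n -> 'I_m) (J : m.-tuple RR) : n.-tuple RR :=
  [tuple tnth J (s i) | i < n].

Lemma measurable_tproj n m (s : 'I_n -> 'I_m) : measurable_fun setT (tproj s).
Proof.
apply/measurable_fun_tnthP => i.
rewrite [X in measurable_fun _ X](_ : _ = (@tnth _ _)^~ (s i)).
  exact: measurable_tnth.
by apply/funext => x /=; rewrite tnth_mktuple.
Qed.

Lemma expect_pprod_proj n m (s : 'I_n -> 'I_m) (g : n.-tuple RR -> R) :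
  injective s -> bmeas g ->
  \int[pprod P m]_J g (tproj s J) = \int[pprod P n]_J g J.
Proof.
elim: n m s g => [|n IHn] m s g s_inj bg.
  rewrite expect_pprod0// -[RHS](expect_cst (pprod P m)).
  by apply: eq_Rintegral => J _; rewrite [tproj s J]tuple0.
case: m => [|m] in s s_inj *; first by case: (s ord0).
have lifts k : {l | s (lift ord0 k) = lift (s ord0) l}.
  have : s ord0 != s (lift ord0 k) by rewrite (inj_eq s_inj).
  by move=> /unlift_some [l sl _]; exists l.
pose s' k := sval (lifts k).
have s'P k : s (lift ord0 k) = lift (s ord0) (s' k) := svalP (lifts k).
have s'_inj : injective s'.
  move=> k l kl; have := congr1 (lift (s ord0)) kl.
  by rewrite -!s'P => /s_inj /lift_inj.
rewrite (expect_pprod_pull (s ord0)); last exact: (bmeas_comp bg (measurable_tproj s)).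
rewrite expect_pprodS//; apply: eq_Rintegral => x _.
rewrite -(IHn _ s' (fun J => g (tcons x J)))//; last first.
  by apply: (bmeas_comp bg); exact: measurable_tcons.
apply: eq_Rintegral => J _; congr g; apply: eq_from_tnth => k; rewrite tnth_mktuple.
case: (unliftP ord0 k) => [l ->|->]; last by rewrite tnth_tinsert tnth0.
by rewrite s'P tnth_tinsert_lift tnthS tnth_mktuple.
Qed.

End marginals.

Section subgraph.
Context {R : realType} (V E V' E' : finType) (ends : E -> V * V) (ends' : E' -> V' * V').
Variables (iota : V -> V') (kappa : E -> E').
Hypotheses (iota_inj : injective iota) (kappa_inj : injective kappa).
Hypothesis kappa_ends : forall e,
  ends' (kappa e) = (iota (ends e).1, iota (ends e).2).

(** Bonds of coupling 0 do not enter the weight, and the remaining angles integrate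
    to 1. *)
Lemma xy_corr_subgraph (K' : E' -> R) x y :
  (forall e', e' \notin [set kappa e | e : E]%SET -> K' e' = 0) ->
  xy_corr ends' K' (iota x) (iota y) = xy_corr ends (K' \o kappa) x y.
Proof.
move=> K'0; pose s (i : 'I_#|V|) := enum_rank (iota (enum_val i)).
have s_inj : injective s by move=> i j /enum_rank_inj /iota_inj /enum_val_inj.
have angleE (t : #|V'|.-tuple (measurableTypeR R)) v :
    angle (tproj s t) v = angle t (iota v).
  by rewrite /angle tnth_mktuple /s enum_rankK.
have weightE t : xy_weight ends' K' t = xy_weight ends (K' \o kappa) (tproj s t).
  rewrite /xy_weight; congr expR.
  rewrite (bigID (fun e' => e' \in [set kappa e | e : E]%SET))/= [X in _ + X]big1 ?addr0.
    rewrite big_imset/=; last by move=> e1 e2 _ _; exact: kappa_inj.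
    by apply: eq_bigr => e _; rewrite kappa_ends/= !angleE.
  by move=> e' /K'0 ->; rewrite mul0r.
have bw := bmeas_xy_weight ends (K' \o kappa); have [bc _] := torus_cos (R := R) x y.
rewrite !xy_corrE; congr (_ / _).
  rewrite -(expect_pprod_proj _ s_inj (bmeasM bc bw)); apply: eq_Rintegral => t _.
  by rewrite weightE /angle_diff !angleE.
by rewrite /xy_Z -(expect_pprod_proj _ s_inj bw); apply: eq_Rintegral => t _.
Qed.

End subgraph.

(** * The infinite-volume limit *)

Section couplings.
Context {R : realType} (V E : finType) (ends : E -> V * V).
Local Notation RR := (measurableTypeR R).

(** The couplings are raised one at a time. *)
Lemma xy_corr_mono (K K' : E -> R) x y :
  (forall e, 0 <= K e) -> (forall e, K e <= K' e) ->
  xy_corr ends K x y <= xy_corr ends K' x y.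
Proof.
move=> K0 KK'; pose mix (s : seq E) e := if e \in s then K' e else K e.
have mix0 s e : 0 <= mix s e.
  by rewrite /mix; case: ifP => _ //; exact: le_trans (KK' e).
have step s : xy_corr ends K x y <= xy_corr ends (mix s) x y.
  elim: s => [|e s IHs]; first by rewrite (_ : mix [::] = K).
  apply: (le_trans IHs).
  have [rmono _] := bond_response_xy_corr ends e x y (mix0 s).
  have set_same : set_bond (mix s) e (mix s e) = mix s.
    by apply/funext => e'; rewrite /set_bond; case: eqP => // ->.
  have set_new : set_bond (mix s) e (K' e) = mix (e :: s).
    apply/funext => e'; rewrite /set_bond /mix in_cons.
    by case: eqP => // ->.
  rewrite -{1}set_same -set_new; apply: rmono => //.
  by rewrite /mix; case: ifP.
have := step (enum E); rewrite (_ : mix (enum E) = K')//.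
by apply/funext => e; rewrite /mix mem_enum.
Qed.

Definition corr_of_tuple x y (K : #|E|.-tuple RR) : R :=
  xy_corr ends (fun e => tnth K (enum_rank e)) x y.

Lemma bmeas_corr_of_tuple x y : bmeas (corr_of_tuple x y).
Proof. by apply: bmeas_xy_corr => e; exact: measurable_tnth. Qed.

Lemma bondwise_response_corr x y : bondwise_response (corr_of_tuple x y).
Proof.
move=> K i K0.
have -> : (fun k => corr_of_tuple x y (tset K i k)) = (fun k =>
    xy_corr ends (set_bond (fun e => tnth K (enum_rank e)) (enum_val i) k) x y).
  apply/funext => k; apply: (congr1 (fun L => xy_corr ends L x y)).
  apply/funext => e; rewrite /set_bond tnth_mktuple.
  by rewrite -(inj_eq enum_val_inj) enum_rankK.
by apply: bond_response_xy_corr => e; exact: K0.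
Qed.

End couplings.

Section boxes.
Context {R : realType}.
Local Notation RR := (measurableTypeR R).
Implicit Types (x y : int * int).

(** Coordinates are counted from the lower left corner, so the box of radius r sits
    inside the box of radius r + 1 after a shift by (1, 1). *)
Definition shift_ord r (i : 'I_(r.*2.+1)) : 'I_(r.+1.*2.+1) := inord i.+1.

Lemma val_shift_ord r (i : 'I_(r.*2.+1)) : shift_ord i = i.+1 :> nat.
Proof. by rewrite inordK//; have := ltn_ord i; lia. Qed.

Lemma shift_ord_inj r : injective (@shift_ord r).
Proof. by move=> i j /(congr1 val); rewrite /= !val_shift_ord => -[] /val_inj. Qed.

Definition shift_box r (v : box r) : box r.+1 := (shift_ord v.1, shift_ord v.2).

Lemma shift_box_inj r : injective (@shift_box r).
Proof.
by move=> [a b] [c d] [] /shift_ord_inj /= -> /shift_ord_inj /= ->.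
Qed.

Lemma box_bond_shift r (p : box r * box r) :
  box_bond (shift_box p.1, shift_box p.2) = box_bond p.
Proof. by rewrite /box_bond/= !val_shift_ord !eqSS. Qed.

Definition shift_edge r (e : box_edge r) : box_edge r.+1 :=
  exist _ (shift_box (val e).1, shift_box (val e).2)
    (etrans (box_bond_shift (val e)) (valP e)).

Lemma shift_edge_inj r : injective (@shift_edge r).
Proof.
move=> e e' /(congr1 val)/= E; apply: val_inj.
have /shift_box_inj E1 := congr1 fst E; have /shift_box_inj E2 := congr1 snd E.
by rewrite [LHS]surjective_pairing E1 E2 -surjective_pairing.
Qed.

Definition in_box r x := (`|x.1| <= r)%N && (`|x.2| <= r)%N.

Lemma in_boxW r s x : (r <= s)%N -> in_box r x -> in_box s x.
Proof. by move=> rs /andP[a b]; rewrite /in_box (leq_trans a)// (leq_trans b). Qed.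

Lemma to_box_shift r x : in_box r x -> to_box r.+1 x = shift_box (to_box r x).
Proof.
have coord (z : int) : (`|z| <= r)%N ->
    (inord `|(z + r.+1%:Z)%R|%N : 'I_(r.+1.*2.+1)) =
    shift_ord (inord `|(z + r%:Z)%R|%N : 'I_(r.*2.+1)).
  move=> zr; apply: val_inj; rewrite /= val_shift_ord !inordK//; lia.
by move=> /andP[a b]; rewrite /to_box /shift_box /= !coord.
Qed.

Variables (M : R) (mu : law R).
Hypotheses (M_ge0 : 0 <= M) (mu_on : law_on M mu).

Lemma box_averaged_corrE b r x y : box_averaged_corr mu b r x y =
  \int[pprod mu #|box_edge r|]_J
    corr_of_tuple (@box_ends r) (to_box r x) (to_box r y) (tscale M b J).
Proof.
rewrite /box_averaged_corr.
pose f (J : #|box_edge r|.-tuple RR) : R := xy_corr (@box_ends r)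
  (fun e => b * tnth J (enum_rank e)) (to_box r x) (to_box r y).
have bf : bmeas f.
  apply: bmeas_xy_corr => e; apply: measurable_funM => //.
  exact: measurable_tnth.
apply: (etrans (expect_pprod_clamp mu_on bf)).
apply: eq_Rintegral => J _.
apply: (congr1 (fun L => xy_corr (@box_ends r) L (to_box r x) (to_box r y))).
by apply/funext => e; rewrite !tnth_mktuple.
Qed.

Lemma box_averaged_corr_le1 b r x y : `|box_averaged_corr mu b r x y| <= 1.
Proof.
rewrite box_averaged_corrE; apply: expect_abs_le => [|J].
  apply: (bmeas_comp (bmeas_corr_of_tuple _ _ _)); exact: measurable_tscale.
exact: xy_corr_norm_le1.
Qed.

(** Setting to 0 the couplings of the larger box outside the smaller one lowers the
    correlation and leaves the model on the smaller box, whose couplings are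
    independent with the same law. *)
Lemma box_averaged_corr_step b r x y : 0 <= b -> in_box r x -> in_box r y ->
  box_averaged_corr mu b r x y <= box_averaged_corr mu b r.+1 x y.
Proof.
move=> b0 xr yr; rewrite !box_averaged_corrE.
set f := corr_of_tuple _ _ _; set g := corr_of_tuple _ _ _.
pose s (i : 'I_#|box_edge r|) := enum_rank (shift_edge (enum_val i)).
have s_inj : injective s by move=> i j /enum_rank_inj /shift_edge_inj /enum_val_inj.
have bf := bmeas_comp (bmeas_corr_of_tuple (@box_ends r) (to_box r x) (to_box r y))
  (@measurable_tscale R M b _).
have bg := bmeas_comp (bmeas_corr_of_tuple (@box_ends r.+1) (to_box r.+1 x) (to_box r.+1 y))
  (@measurable_tscale R M b _).
rewrite -(expect_pprod_proj mu s_inj bf); apply: le_expect => // [|J].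
  exact: (bmeas_comp bf (measurable_tproj s)).
rewrite /g /corr_of_tuple !to_box_shift//.
pose K' (e' : box_edge r.+1) : R :=
  if e' \in [set shift_edge e | e : box_edge r]%SET
  then tnth (tscale M b J) (enum_rank e') else 0.
have J0 i : 0 <= tnth (tscale M b J) i by rewrite tnth_mktuple mulr_ge0 ?clamp_ge0.
have K'out e' : e' \notin [set shift_edge e | e : box_edge r]%SET -> K' e' = 0.
  by rewrite /K' => /negbTE ->.
apply: (@le_trans _ _ (xy_corr (@box_ends r.+1) K' (shift_box (to_box r x))
    (shift_box (to_box r y)))); last first.
  by apply: xy_corr_mono => e'; rewrite /K'; case: ifP.
have kappa_ends (e : box_edge r) : box_ends (shift_edge e) =
    (shift_box (box_ends e).1, shift_box (box_ends e).2) by [].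
have -> := xy_corr_subgraph (@shift_box_inj r) (@shift_edge_inj r) kappa_ends
  (to_box r x) (to_box r y) K'out.
rewrite le_eqVlt; apply/orP; left; apply/eqP.
apply: (congr1 (fun L => xy_corr (@box_ends r) L (to_box r x) (to_box r y))).
apply/funext => e; rewrite /K' /= imset_f//.
by rewrite !tnth_mktuple /s enum_rankK.
Qed.

Lemma is_cvg_box_averaged_corr b x y : 0 <= b ->
  cvgn (fun r => box_averaged_corr mu b r x y).
Proof.
move=> b0.
pose r0 := maxn (maxn `|x.1| `|x.2|)%N (maxn `|y.1| `|y.2|)%N.
have inx : in_box r0 x by rewrite /in_box /r0; lia.
have iny : in_box r0 y by rewrite /in_box /r0; lia.
pose u n := box_averaged_corr mu b (n + r0)%N x y.
suff /cvg_ex[l ul] : cvgn u.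
  by apply/cvg_ex; exists l; rewrite -(cvg_shiftn r0).
apply: nondecreasing_is_cvgn.
  apply/nondecreasing_seqP => n; rewrite /u addSn.
  by apply: box_averaged_corr_step => //; apply: in_boxW (leq_addl _ _) _.
exists 1 => _ [n _ <-].
by have := box_averaged_corr_le1 b (n + r0) x y; rewrite ler_norml => /andP[].
Qed.

End boxes.

Section averaged_comparison.
Context {R : realType}.
Local Notation RR := (measurableTypeR R).
Variables (P Q : law R) (S : set RR) (m M b b' : R).
Hypotheses (P_on : law_on M P) (Q_on : law_on M Q).
Hypotheses (mS : measurable S) (Sm : forall j, S j -> m <= j).
Hypotheses (m_ge0 : 0 <= m) (mM : m <= M).
Hypotheses (b_ge0 : 0 <= b) (bb' : b <= b').
Hypothesis PS_gt0 : 0 < fine (P S).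
Hypothesis gain : (fine (P S) + tv_dist P Q) * bondH (b * M) <=
                  fine (P S) * bondH (b' * m).

Lemma averaged_corr_comparison x y :
  averaged_corr Q b x y <= averaged_corr P b' x y.
Proof.
have M_ge0 : 0 <= M by exact: le_trans mM.
have b'_ge0 : 0 <= b' by exact: le_trans bb'.
apply: ler_lim; [exact: (is_cvg_box_averaged_corr M_ge0 Q_on)|
                 exact: (is_cvg_box_averaged_corr M_ge0 P_on)|].
apply: nearW => r.
rewrite (box_averaged_corrE Q_on) (box_averaged_corrE P_on).
exact: (all_bonds_comparison mS Sm m_ge0 mM b_ge0 bb' PS_gt0 gain
  (bmeas_corr_of_tuple (@box_ends r) (to_box r x) (to_box r y))
  (bondwise_response_corr (@box_ends r) (to_box r x) (to_box r y))).
Qed.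

Lemma c_alg_le : (exists c0 s : R, [/\ 0 < c0, 0 <= s &
      forall x, x != (0, 0) ->
        c0 * (1 + euclid_norm R x) `^ (- s) <= averaged_corr Q b (0, 0) x]) ->
  (c_alg P <= b'%:E)%E.
Proof.
move=> [c0 [s [c00 s0 H]]]; apply: ereal_inf_lbound; exists b'; last by [].
split; first exact: le_trans bb'.
exists c0, s; split; [exact: c00|exact: s0|move=> x x0].
exact: (le_trans (H x x0) (averaged_corr_comparison _ _)).
Qed.

Lemma c_chi_le :
  (\esum_(x in [set: int * int]) (averaged_corr Q b (0, 0) x)%:E = +oo)%E ->
  (c_chi P <= b'%:E)%E.
Proof.
move=> H; apply: ereal_inf_lbound; exists b'; last by [].
split; first exact: le_trans bb'.
apply/eqP; rewrite -leye_eq -[X in (X <= _)%E]H; apply: le_esum => x _.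
by rewrite lee_fin; exact: averaged_corr_comparison.
Qed.

End averaged_comparison.

(** * Comparison of the thresholds *)

Section threshold.
Context {R : realType}.
Local Notation RR := (measurableTypeR R).
Variable M : R.
Hypothesis M_gt0 : 0 < M.

Lemma HM_fin (t : R) : HM M t%:E = bondH (t * M).
Proof. by rewrite /HM /bondH/=; congr (1 - expR (- _)); ring. Qed.

Lemma HM_pinfty : HM M +oo%E = 1.
Proof. by rewrite /HM mulry gtr0_sg ?mulr_gt0// mul1e/= subr0. Qed.

Lemma HM_le1 t : (0 <= t)%E -> HM M t <= 1.
Proof.
case: t => [t _||//]; last by rewrite HM_pinfty.
by rewrite HM_fin ltW// bondH_lt1.
Qed.

Lemma HM_ge0 t : (0 <= t)%E -> 0 <= HM M t.
Proof.
case: t => [t t0||//]; last by rewrite HM_pinfty.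
by rewrite HM_fin bondH_ge0// mulr_ge0 ?(ltW M_gt0)// -lee_fin.
Qed.

Lemma bondH_lipschitz (q b : R) : 0 <= q -> q <= b -> bondH b - bondH q <= 2 * (b - q).
Proof.
move=> q0 qb; rewrite /bondH.
have -> : expR (- (2 * b)) = expR (- (2 * q)) * expR (- (2 * (b - q))).
  by rewrite -expRD; congr expR; ring.
have := expR_ge1Dx (- (2 * (b - q))); have := expR_gt0 (- (2 * q)).
have : expR (- (2 * q)) <= 1 by rewrite -[leRHS]expR0 ler_expR oppr_le0 mulr_ge0.
set s := expR _; set t := expR _ => s1 s0 t1.
have : s * (1 - t) <= 1 * (2 * (b - q)).
  apply: ler_pM => //; [exact: ltW| |by lra].
  by rewrite subr_ge0 -expR0 ler_expR oppr_le0 mulr_ge0// subr_ge0.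
by lra.
Qed.

Variable c : law R -> \bar R.
Hypothesis c_def : c = @c_alg R \/ c = @c_chi R.

(** All that is used of the two thresholds: each is the infimum of a set T of inverse
    temperatures that is transported by the comparison of averaged correlations. *)
Lemma thresholdP : exists T : law R -> set R,
  [/\ forall P, c P = ereal_inf [set b%:E | b in T P],
      forall P b, T P b -> 0 <= b &
      forall (P Q : law R) (S : set RR) m b b', law_on M P -> law_on M Q ->
        measurable S -> (forall j, S j -> m <= j) -> 0 <= m -> m <= M ->
        b <= b' -> 0 < fine (P S) ->
        (fine (P S) + tv_dist P Q) * bondH (b * M) <= fine (P S) * bondH (b' * m) ->
        T Q b -> (c P <= b'%:E)%E].
Proof.
case: c_def => ->.
  exists (fun P => [set b : R | 0 <= b /\ exists c0 s : R, [/\ 0 < c0, 0 <= s &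
      forall x, x != (0, 0) ->
        c0 * (1 + euclid_norm R x) `^ (- s) <= averaged_corr P b (0, 0) x]]).
  split; first by [].
    by move=> P b [].
  move=> P Q S m b b' PM QM mS Sm m0 mM bb' PS gain [b0 H].
  exact: (c_alg_le PM QM mS Sm m0 mM b0 bb' PS gain H).
exists (fun P => [set b : R | 0 <= b /\
    (\esum_(x in [set: int * int]) (averaged_corr P b (0, 0) x)%:E = +oo)%E]).
split; first by [].
  by move=> P b [].
move=> P Q S m b b' PM QM mS Sm m0 mM bb' PS gain [b0 H].
exact: (c_chi_le PM QM mS Sm m0 mM b0 bb' PS gain H).
Qed.

Lemma threshold_ge0 P : (0 <= c P)%E.
Proof.
have [T [cE T0 _]] := thresholdP; rewrite cE; apply: le_ereal_inf_tmp => _ [b Tb <-].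
by rewrite lee_fin; exact: T0 Tb.
Qed.

Lemma threshold_lt_ex P (x : R) : (c P < x%:E)%E ->
  exists b, [/\ b < x, (c P <= b%:E)%E &
    forall (P' : law R) (S : set RR) m b', law_on M P' -> law_on M P ->
        measurable S -> (forall j, S j -> m <= j) -> 0 <= m -> m <= M ->
        b <= b' -> 0 < fine (P' S) ->
        (fine (P' S) + tv_dist P' P) * bondH (b * M) <= fine (P' S) * bondH (b' * m) ->
        (c P' <= b'%:E)%E].
Proof.
have [T [cE T0 TP]] := thresholdP; rewrite cE => /ereal_inf_lt[_ [b Tb <-] bx].
exists b; split; first by rewrite -lte_fin.
  by apply: ereal_inf_lbound; exists b.
move=> P' S m b' P'M PM mS Sm m0 mM bb' PS gain.
exact: (TP P' P S m b b' P'M PM mS Sm m0 mM bb' PS gain Tb).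
Qed.

(** Otherwise some b in T(Q), close to c(Q), would satisfy
    v := (p + d) / p H(bM) < HM(c(P)) <= 1.  The b' with H(b'M) = v meets
    the condition of [thresholdP] with m = M, so c(P) <= b' and HM(c(P)) <= v. *)
Lemma atom_comparison P Q : law_on M P -> law_on M Q -> 0 < fine (P [set M]) ->
  HM M (c P) * fine (P [set M]) <=
  (fine (P [set M]) + tv_dist P Q) * HM M (c Q).
Proof.
move=> PM QM; set p := fine (P [set M]) => p0; set dl := tv_dist P Q.
have dl0 : 0 <= dl := tv_dist_ge0 P Q.
have pd0 : 0 < p + dl by rewrite ltr_wpDr.
have HP1 := HM_le1 (threshold_ge0 P).
case: (c Q) (threshold_ge0 Q) (threshold_lt_ex (P := Q)) => [q q0 ex|_ _|//]; last first.
  rewrite HM_pinfty mulr1 (@le_trans _ _ p) ?lerDl//.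
  by rewrite ler_piMl// ltW.
rewrite HM_fin leNgt; apply/negP => lt.
rewrite lee_fin in q0.
set gap := HM M (c P) * p - (p + dl) * bondH (q * M).
have gap0 : 0 < gap by rewrite subr_gt0.
(* t -> H(tM) is 2M-Lipschitz on t >= 0 *)
pose eta := gap / (2 * M * (p + dl)).
have den0 : 0 < 2 * M * (p + dl) by rewrite !mulr_gt0.
have eta0 : 0 < eta by rewrite divr_gt0.
have [b [bq qb bP]] := ex (q + eta) (eqbRL (lte_fin _ _) (ltr_pwDr eta0 (lexx q))).
rewrite lee_fin in qb.
have b0 : 0 <= b by exact: le_trans qb.
have Hb : (p + dl) * bondH (b * M) < HM M (c P) * p.
  have lip : bondH (b * M) - bondH (q * M) <= 2 * (b * M - q * M).
    by apply: bondH_lipschitz; rewrite ?mulr_ge0 ?ler_wpM2r// (ltW M_gt0).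
  have : (p + dl) * (bondH (b * M) - bondH (q * M)) < gap.
    rewrite (le_lt_trans (ler_wpM2l (ltW pd0) lip))//.
    have -> : (p + dl) * (2 * (b * M - q * M)) = (b - q) * (2 * M * (p + dl)) by ring.
    by rewrite -ltr_pdivlMr// ltrBlDl.
  by rewrite /gap; lra.
pose v := (p + dl) / p * bondH (b * M).
have vE : p * v = (p + dl) * bondH (b * M) by rewrite /v; field; rewrite gt_eqF.
have vlt : v < HM M (c P) by rewrite -(ltr_pM2l p0) vE mulrC mulrC [ltRHS]mulrC.
have v1 : 0 < 1 - v by rewrite subr_gt0 (lt_le_trans vlt).
pose b' := - ln (1 - v) / (2 * M).
have Hb' : bondH (b' * M) = v.
  rewrite /bondH (_ : - (2 * (b' * M)) = ln (1 - v)); first by rewrite lnK ?posrE// subKr.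
  by rewrite /b'; field; rewrite gt_eqF.
have bb' : b <= b'.
  rewrite -(ler_pM2r M_gt0) -bondH_mono Hb' /v ler_peMl ?bondH_ge0 ?mulr_ge0 ?(ltW M_gt0)//.
  by rewrite ler_pdivlMr// mul1r lerDl.
have : (c P <= b'%:E)%E.
  apply: (bP P [set M] M b') => //.
  - by move=> j /= ->.
  - exact: ltW.
  - by rewrite -/p -/dl Hb' vE.
have := threshold_ge0 P; case: (c P) vlt => [t vlt t0|//|//].
rewrite lee_fin => tb'; move: vlt; rewrite HM_fin -Hb' ltNge bondH_mono.
by rewrite ler_wpM2r// (ltW M_gt0).
Qed.

End threshold.

(** * Stability at a law *)

Section stability.
Context {R : realType}.
Local Notation RR := (measurableTypeR R).
Variable M : R.
Hypothesis M_gt0 : 0 < M.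
Variable c : law R -> \bar R.
Hypothesis c_def : c = @c_alg R \/ c = @c_chi R.
Variable mu : law R.
Hypothesis mu_on : law_on M mu.
Hypotheses (c_gt0 : (0 < c mu)%E) (c_fin : (c mu < +oo)%E).

Let cm := fine (c mu).

Let cmE : c mu = cm%:E.
Proof. by rewrite /cm fineK// ge0_fin_numE// ltW. Qed.

Let cm_gt0 : 0 < cm.
Proof. by rewrite -lte_fin -cmE. Qed.

Section atom.
Variable a : R.
Hypotheses (mu_a : mu [set M] = a%:E) (a_gt0 : 0 < a).

Let q := expR (- (2 * M * cm)).
Let q_gt0 : 0 < q. Proof. exact: expR_gt0. Qed.
Let q_lt1 : q < 1.
Proof. by rewrite -expR0 ltr_expR oppr_lt0 !mulr_gt0. Qed.

Let HM_mu : HM M (c mu) = 1 - q.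
Proof. by rewrite cmE HM_fin /bondH /q; congr (1 - expR (- _)); ring. Qed.

Let atom_ge nu : a - tv_dist nu mu <= fine (nu [set M]).
Proof.
have := tv_dist_ub nu mu (measurable_set1 M).
by rewrite mu_a /= ler_norml => /andP[+ _]; lra.
Qed.

Lemma atom_lower nu : law_on M nu ->
  HM M (c mu) / (1 + tv_dist nu mu / a) <= HM M (c nu).
Proof.
move=> nu_on; have dl0 := tv_dist_ge0 nu mu.
have := atom_comparison M_gt0 c_def mu_on nu_on; rewrite mu_a/= tv_distC => /(_ a_gt0) h.
rewrite ler_pdivrMr; last by rewrite ltr_wpDr// divr_ge0// ltW.
rewrite -(ler_pM2r a_gt0) (le_trans h)//.
by rewrite le_eqVlt; apply/orP; left; apply/eqP; field; rewrite gt_eqF.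
Qed.

Lemma atom_upper nu : law_on M nu -> tv_dist nu mu < a ->
  HM M (c nu) <= HM M (c mu) / (1 - tv_dist nu mu / a).
Proof.
move=> nu_on dla; have dl0 := tv_dist_ge0 nu mu.
have pa := atom_ge nu; set p := fine (nu [set M]) in pa; set dl := tv_dist nu mu in pa dla dl0 *.
have p0 : 0 < p by rewrite (lt_le_trans _ pa)// subr_gt0.
have := atom_comparison M_gt0 c_def nu_on mu_on; rewrite -/p -/dl => /(_ p0) h.
have h0 : 0 <= HM M (c mu) by rewrite HM_mu subr_ge0 ltW.
have h1 : 0 <= HM M (c nu) by apply: HM_ge0 => //; exact: (threshold_ge0 M c_def).
have x1 : 0 < 1 - dl / a by rewrite subr_gt0 ltr_pdivrMr// mul1r.
rewrite ler_pdivlMr// -(ler_pM2r a_gt0).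
have -> : HM M (c nu) * (1 - dl / a) * a = HM M (c nu) * (a - dl).
  by field; rewrite gt_eqF.
rewrite -(ler_pM2r p0).
have e1 : HM M (c nu) * p * (a - dl) <= (p + dl) * HM M (c mu) * (a - dl).
  by rewrite ler_wpM2r// subr_ge0 ltW.
have e2 : (p + dl) * (a - dl) <= a * p by nra.
have e3 : (p + dl) * (a - dl) * HM M (c mu) <= a * p * HM M (c mu) by rewrite ler_wpM2r.
by move: e1 e3; lra.
Qed.

Let r := a * q / 2.
Let r_gt0 : 0 < r. Proof. by rewrite /r !mulr_gt0// invr_gt0. Qed.

(** The lower bound q / 2 on exp(-2Mc) keeps c away from +oo, uniformly near mu; it
    is what makes the passage from HM(c) back to c Lipschitz. *)
Lemma near_atom nu : law_on M nu -> tv_dist nu mu < r ->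
  c nu \is a fin_num /\ q / 2 <= expR (- (2 * M * fine (c nu))).
Proof.
move=> nu_on dlr; have dl0 := tv_dist_ge0 nu mu.
set dl := tv_dist nu mu in dlr dl0 *.
have ra : r < a.
  have : a * q < a * 1 by rewrite ltr_pM2l.
  by have := mulr_gt0 a_gt0 q_gt0; rewrite /r; lra.
have up := atom_upper nu_on (lt_trans dlr ra); rewrite -/dl HM_mu in up.
have x1 : dl / a < q / 2.
  by rewrite ltr_pdivrMr//; apply: (lt_le_trans dlr); rewrite /r; lra.
have x0 : 0 <= dl / a by rewrite divr_ge0// ltW.
set x := dl / a in x1 x0 up *.
have up2 : HM M (c nu) <= 1 - q / 2.
  apply: (le_trans up); rewrite ler_pdivrMr; last by move: q_lt1; lra.
  by have := q_gt0; have := q_lt1; nra.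
have := threshold_ge0 M c_def nu; case: (c nu) up2 => [t|up2|//]; last first.
  by move: up2; rewrite HM_pinfty//; have := q_gt0; lra.
rewrite HM_fin /bondH/= => h _; split => //.
have -> : 2 * M * t = 2 * (t * M) by ring.
by move: h; lra.
Qed.

(** The convexity inequality exp(u) >= 1 + u at u = t - s. *)
Lemma expR_gap (s t : R) : expR (- t) * (t - s) <= expR (- s) - expR (- t).
Proof.
have -> : expR (- s) = expR (- t) * expR (t - s) by rewrite -expRD; congr expR; ring.
have := expR_ge1Dx (t - s); have := expR_gt0 (- t); nra.
Qed.

(** Near mu the atom of nu1 has mass at least a / 2, so [atom_comparison] bounds the
    difference of the HM(c) by 2d / a; dividing by the slope 2M q / 2 of HM gives the
    difference of the thresholds. *)
Lemma atom_lipschitz nu1 nu2 : law_on M nu1 -> law_on M nu2 ->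
  tv_dist nu1 mu < r -> tv_dist nu2 mu < r ->
  fine (c nu1) - fine (c nu2) <= 2 / (a * M * q) * tv_dist nu1 nu2.
Proof.
move=> on1 on2 d1 d2.
have [f1 e1] := near_atom on1 d1; have [f2 e2] := near_atom on2 d2.
have pa := atom_ge nu1; set p := fine (nu1 [set M]) in pa.
have p2 : a / 2 <= p.
  have : a * q < a * 1 by rewrite ltr_pM2l.
  by move: pa d1; rewrite /r; lra.
have p0 : 0 < p by rewrite (lt_le_trans _ p2)// divr_gt0.
have := atom_comparison M_gt0 c_def on1 on2; rewrite -/p => /(_ p0).
set dl := tv_dist nu1 nu2; have dl0 : 0 <= dl := tv_dist_ge0 nu1 nu2.
have cE nu : c nu \is a fin_num -> HM M (c nu) = 1 - expR (- (2 * M * fine (c nu))).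
  by move=> /fineK {1}<-; rewrite HM_fin /bondH; congr (1 - expR (- _)); ring.
rewrite !cE//; have := expR_gap (2 * M * fine (c nu2)) (2 * M * fine (c nu1)).
have := expR_gt0 (- (2 * M * fine (c nu2))).
set E1 := expR _ in e1 *; set E2 := expR _ in e2 *.
set t1 := fine _; set t2 := fine _ => E20 gap h.
have [t12|/ltW t21] := leP t1 t2.
  apply: (@le_trans _ _ 0); first by rewrite subr_le0.
  by rewrite mulr_ge0// divr_ge0// ltW// !mulr_gt0.
have k1 : p * (E2 - E1) <= dl by nra.
have k2 : a / 2 * (E2 - E1) <= dl.
  apply: le_trans k1; rewrite ler_wpM2r// (le_trans _ gap)// mulr_ge0 ?expR_ge0//.
  by rewrite -mulrBr !mulr_ge0 ?subr_ge0// (ltW M_gt0).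
have k3 : q / 2 * (2 * M * t1 - 2 * M * t2) <= E2 - E1.
  apply: le_trans gap; rewrite ler_wpM2r// -mulrBr !mulr_ge0 ?subr_ge0//.
  exact: ltW M_gt0.
have k4 : a / 2 * (q / 2 * (2 * M * t1 - 2 * M * t2)) <= dl.
  by apply: le_trans k2; rewrite ler_wpM2l// divr_ge0// ltW.
rewrite -(ler_pM2l (_ : 0 < a / 2 * (q / 2) * (2 * M))); last first.
  by rewrite !mulr_gt0// ?invr_gt0.
have -> : a / 2 * (q / 2) * (2 * M) * (2 / (a * M * q) * dl) = dl.
  by field; rewrite !gt_eqF.
by apply: le_trans k4; rewrite le_eqVlt; apply/orP; left; apply/eqP; ring.
Qed.

(** In terms of x = d / a, the two bounds on HM(c(nu)) give
    2M (c(mu) - c(nu)) <= (1/q - 1) x  and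
    2M (c(nu) - c(mu)) <= (1/q - 1) x / (1 - x/q), and 1 / (1 - y) <= 1 + 2y for
    0 <= y <= 1/2. *)
Lemma atom_first_order nu : law_on M nu -> tv_dist nu mu < r ->
  `|fine (c nu) - cm| <= (expR (2 * M * cm) - 1) / (2 * M * a) * tv_dist nu mu
    + (q^-1 - 1) / (q * M * a ^+ 2) * tv_dist nu mu ^+ 2.
Proof.
move=> nu_on dlr; have [fnu _] := near_atom nu_on dlr.
have dl0 := tv_dist_ge0 nu mu; have lo := atom_lower nu_on.
have ra : r < a.
  have : a * q < a * 1 by rewrite ltr_pM2l.
  by have := mulr_gt0 a_gt0 q_gt0; rewrite /r; lra.
have up := atom_upper nu_on (lt_trans dlr ra).
set dl := tv_dist nu mu in dlr dl0 lo up *.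
have -> : expR (2 * M * cm) = q^-1 by rewrite /q expRN invrK.
have q0 := q_gt0; have q1 := q_lt1.
pose x := dl / a.
have dlE : dl = x * a by rewrite /x divfK ?gt_eqF.
have x0 : 0 <= x by rewrite divr_ge0// ltW.
have xq : x < q / 2 by rewrite /x ltr_pdivrMr//; apply: (lt_le_trans dlr); rewrite /r; lra.
move: lo up; rewrite -/x HM_mu -[c nu]fineK// HM_fin /bondH.
have -> : 2 * (fine (c nu) * M) = 2 * M * fine (c nu) by ring.
set t := fine (c nu); set E := expR _ => lo up.
rewrite ler_pdivrMr in lo; last by lra.
rewrite ler_pdivlMr in up; last by lra.
pose k := q^-1 - 1.
have k0 : 0 <= k by rewrite subr_ge0 invf_ge1// ltW.
have kq : k * q = 1 - q by rewrite /k mulrBl mulVf ?gt_eqF// mul1r.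
have gap1 : q * (2 * M * cm - 2 * M * t) <= E - q := expR_gap (2 * M * t) (2 * M * cm).
have gap2 : E * (2 * M * t - 2 * M * cm) <= q - E := expR_gap (2 * M * cm) (2 * M * t).
have -> : k / (2 * M * a) * dl + k / (q * M * a ^+ 2) * dl ^+ 2 =
    (k * x + k * x * (2 * x / q)) / (2 * M).
  by rewrite dlE; field; rewrite !gt_eqF.
have M20 : 0 < 2 * M by rewrite mulr_gt0.
have E0 : 0 < E by exact: expR_gt0.
have y0 : 0 <= x / q by rewrite divr_ge0// ltW.
have xE : x = x / q * q by rewrite divfK// gt_eqF.
have y1 : x / q < 2^-1 by rewrite ltr_pdivrMr//; lra.
have bound1 : 2 * M * cm - 2 * M * t <= k * x.
  rewrite -(ler_pM2l q0) (le_trans gap1)//.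
  have -> : q * (k * x) = (1 - q) * x by rewrite -kq; ring.
  by nra.
have bound2 : 2 * M * t - 2 * M * cm <= k * x + k * x * (2 * x / q).
  have e1 : q - x <= E * (1 - x) by lra.
  have d0 : 0 < q - x by lra.
  have [tc|/ltW ct] := leP (2 * M * t) (2 * M * cm).
    apply: (@le_trans _ _ 0); first by rewrite subr_le0.
    by rewrite addr_ge0 ?mulr_ge0 ?invr_ge0// ltW.
  have e2 : (q - x) * (2 * M * t - 2 * M * cm) <= q * (1 - x) - (q - x).
    set u := 2 * M * t - 2 * M * cm in gap2 *.
    have u0 : 0 <= u by rewrite subr_ge0.
    have : (q - x) * u <= E * (1 - x) * u by rewrite ler_wpM2r.
    have : (1 - x) * (E * u) <= (1 - x) * (q - E) by rewrite ler_wpM2l//; lra.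
    by lra.
  rewrite -(ler_pM2l d0) (le_trans e2)//.
  set y := x / q in xE y0 y1 *.
  have -> : 2 * x / q = 2 * y by rewrite /y mulrA.
  have -> : q * (1 - x) - (q - x) = k * q * x by rewrite kq; ring.
  have -> : (q - x) * (k * x + k * x * (2 * y)) = k * q * x * ((1 - y) * (1 + 2 * y)).
    by rewrite {1}xE; ring.
  have yy : 0 <= y * (1 - 2 * y) by rewrite mulr_ge0//; lra.
  have f1 : 1 <= (1 - y) * (1 + 2 * y) by lra.
  apply: ler_peMr f1.
  by apply: mulr_ge0 => //; apply: mulr_ge0 => //; exact: ltW.
have -> : fine (c nu) - cm = (2 * M * t - 2 * M * cm) / (2 * M).
  by rewrite /t; field; rewrite gt_eqF.
rewrite normrM (ger0_norm (x := (2 * M)^-1)) ?invr_ge0 ?(ltW M20)//.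
rewrite ler_pM2r ?invr_gt0// ler_norml bound2 andbT.
have : 0 <= k * x * (2 * x / q) by rewrite !mulr_ge0// ?invr_ge0 ltW.
by move: bound1; lra.
Qed.

End atom.

(** Choose m < M with b'm > bM; the half-line ]m, +oo[ has positive mass because M is
    the essential supremum, and the strict inequality H(bM) < H(b'm) leaves
    room for a small total variation distance. *)
Lemma ess_sup_window (b b' : R) : law_ess_sup mu = M%:E -> 0 < b -> b < b' ->
  exists m (S : set RR) r, [/\ measurable S, forall j, S j -> m <= j, 0 <= m <= M,
    0 < fine (mu S) & 0 < r /\ forall nu, tv_dist nu mu < r ->
    [/\ 0 < fine (nu S),
     (fine (nu S) + tv_dist nu mu) * bondH (b * M) <= fine (nu S) * bondH (b' * m) &
     (fine (mu S) + tv_dist mu nu) * bondH (b * M) <= fine (mu S) * bondH (b' * m)]].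
Proof.
move=> esup b0 bb'; have b'0 : 0 < b' by exact: lt_trans bb'.
pose m := (M + b * M / b') / 2.
have bb1 : b / b' < 1 by rewrite ltr_pdivrMr// mul1r.
have bbM : b * M / b' < M by rewrite mulrAC -[ltRHS]mul1r ltr_pM2r.
have bb0 : 0 < b * M / b' by rewrite divr_gt0// mulr_gt0.
have m0 : 0 < m by rewrite /m; lra.
have mM : m < M by rewrite /m; lra.
have bm : b * M < b' * m.
  have -> : b' * m = (b' * M + b * M) / 2 by rewrite /m; field; rewrite gt_eqF.
  by have : b * M < b' * M by [rewrite ltr_pM2r]; lra.
pose S : set RR := [set` `]m, +oo[].
have mS : measurable S by exact: measurable_itv.
have fS (nu : law R) : nu S \is a fin_num by exact: fin_num_measure.
have p0 : 0 < fine (mu S).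
  rewrite lt_neqAle fine_ge0 ?measure_ge0// andbT eq_sym; apply/eqP => muS0.
  have : (M%:E <= m%:E)%E.
    rewrite -esup; apply: ereal_inf_lbound; exists m => //=.
    by rewrite -/S -[LHS]fineK ?fS// muS0.
  by rewrite lee_fin leNgt mM.
set p := fine (mu S) in p0 *.
set H := bondH (b * M); set H' := bondH (b' * m).
have H0 : 0 < H by rewrite bondH_gt0 mulr_gt0.
have HH' : H < H' by rewrite (leW_mono (@bondH_mono R)).
have H'0 : 0 < H' by exact: lt_trans HH'.
exists m, S, (p * (H' - H) / H'); split => //.
- by move=> j; rewrite /S/= in_itv/= andbT => /ltW.
- by rewrite !ltW.
split; first by rewrite divr_gt0// mulr_gt0// subr_gt0.
move=> nu; rewrite ltr_pdivlMr// => dl.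
have dl0 := tv_dist_ge0 nu mu; rewrite (tv_distC mu nu).
set d := tv_dist nu mu in dl dl0 *.
have pnu : p - d <= fine (nu S).
  have := tv_dist_ub nu mu mS.
  by rewrite ler_norml -/p -/d => /andP[+ _]; lra.
set p' := fine (nu S) in pnu *.
split.
- apply: lt_le_trans pnu; rewrite subr_gt0 -(ltr_pM2r H'0) (lt_trans dl)//.
  by rewrite ltr_pM2l// ltrBlDr ltrDl.
- have : (p - d) * (H' - H) <= p' * (H' - H) by rewrite ler_wpM2r// subr_ge0 ltW.
  by move: dl; rewrite -/H -/H' -/p; lra.
- have : d * H <= d * H' by rewrite ler_wpM2l// ltW.
  by move: dl; rewrite -/H -/H' -/p; lra.
Qed.

Lemma ess_sup_continuity : law_ess_sup mu = M%:E ->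
  forall eps : R, 0 < eps -> exists2 r : R, 0 < r &
    forall nu : law R, law_on M nu -> tv_dist nu mu < r ->
      c nu \is a fin_num /\ `|fine (c nu) - cm| < eps.
Proof.
move=> esup eps eps0.
have up : exists2 r : R, 0 < r & forall nu : law R, law_on M nu -> tv_dist nu mu < r ->
    (c nu < (cm + eps)%:E)%E.
  have [|b [bx cb bP]] := @threshold_lt_ex R M c c_def mu (cm + eps / 2).
    by rewrite cmE lte_fin ltrDl divr_gt0.
  rewrite cmE lee_fin in cb.
  have b0 : 0 < b by exact: lt_le_trans cb.
  have [m [S [r [mS Sm /andP[m0 mM] _ [r0 rP]]]]] := ess_sup_window esup b0 bx.
  exists r => // nu nu_on /rP[nuS gain _].
  apply: (@le_lt_trans _ _ (cm + eps / 2)%:E).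
    exact: (bP nu S m _ nu_on mu_on mS Sm m0 mM (ltW bx) nuS gain).
  by rewrite lte_fin; lra.
have lo : exists2 r : R, 0 < r & forall nu : law R, law_on M nu -> tv_dist nu mu < r ->
    ((cm - eps)%:E < c nu)%E.
  pose e := Num.min eps cm.
  have e0 : 0 < e by rewrite lt_min eps0 cm_gt0.
  have eeps : e <= eps by rewrite ge_min lexx.
  have ecm : e <= cm by rewrite ge_min lexx orbT.
  pose b0 := cm - e / 2; pose b' := cm - e / 4.
  have b00 : 0 < b0 by rewrite /b0; lra.
  have b0b' : b0 < b' by rewrite /b0 /b'; lra.
  have [m [S [r [mS Sm /andP[m0 mM] muS [r0 rP]]]]] := ess_sup_window esup b00 b0b'.
  exists r => // nu nu_on /rP[_ _ gain].
  apply: (@lt_le_trans _ _ b0%:E); first by rewrite lte_fin /b0; lra.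
  rewrite leNgt; apply/negP => /(threshold_lt_ex M c_def)[b [bb0 cb bP]].
  have b_ge0 : 0 <= b.
    by rewrite -lee_fin (le_trans (threshold_ge0 M c_def nu)).
  have : (c mu <= b'%:E)%E.
    apply: (bP mu S m b' mu_on nu_on mS Sm m0 mM _ muS _).
      by rewrite ltW// (lt_trans bb0).
    apply: le_trans gain; rewrite ler_wpM2l//.
      by rewrite addr_ge0 ?tv_dist_ge0// ltW.
    by rewrite bondH_mono ler_wpM2r// ltW.
  by rewrite cmE lee_fin /b'; lra.
have [r1 r10 up1] := up; have [r2 r20 lo2] := lo.
exists (Num.min r1 r2); first by rewrite lt_min r10.
move=> nu nu_on; rewrite lt_min => /andP[d1 d2].
have := up1 _ nu_on d1; have := lo2 _ nu_on d2.
case: (c nu) => [t||]//; rewrite !lte_fin/= => lt gt; split => //.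
by rewrite ltr_norml; apply/andP; split; lra.
Qed.

End stability.

Theorem theorem6p1 (R : realType) (M : R) (M_gt0 : 0 < M)
  (mu : law R) (mu_on : law_on M mu)
  (c : law R -> \bar R) (c_def : c = @c_alg R \/ c = @c_chi R)
  (c_gt0 : (0 < c mu)%E) (c_fin : (c mu < +oo)%E) :
  (forall a : R, mu [set M] = a%:E -> 0 < a ->
    [/\ (forall nu : law R, law_on M nu ->
          tv_dist nu mu < a * expR (- (2 * M * fine (c mu))) ->
          [/\ HM M (c mu) / (1 + tv_dist nu mu / a) <= HM M (c nu),
              HM M (c nu) <= HM M (c mu) / (1 - tv_dist nu mu / a) &
              HM M (c mu) / (1 - tv_dist nu mu / a) < 1]),
        (exists r L : R, [/\ 0 < r, 0 <= L &
          (forall nu : law R, law_on M nu -> tv_dist nu mu < r ->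
            c nu \is a fin_num) /\
          (forall nu1 nu2 : law R, law_on M nu1 -> law_on M nu2 ->
            tv_dist nu1 mu < r -> tv_dist nu2 mu < r ->
            `|fine (c nu1) - fine (c nu2)| <= L * tv_dist nu1 nu2)]) &
        (exists r C : R, 0 < r /\
          (forall nu : law R, law_on M nu -> tv_dist nu mu < r ->
            c nu \is a fin_num /\
            `|fine (c nu) - fine (c mu)| <=
              (expR (2 * M * fine (c mu)) - 1) / (2 * M * a) * tv_dist nu mu
              + C * tv_dist nu mu ^+ 2))])
  /\
  (law_ess_sup mu = M%:E ->
    forall eps : R, 0 < eps -> exists2 r : R, 0 < r &
      forall nu : law R, law_on M nu -> tv_dist nu mu < r ->
        c nu \is a fin_num /\ `|fine (c nu) - fine (c mu)| < eps).
Proof.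
split; last by move=> esup; exact: (ess_sup_continuity M_gt0 c_def mu_on c_gt0 c_fin esup).
move=> a mu_a a_gt0; set q := expR (- (2 * M * fine (c mu))).
have q_gt0 : 0 < q by exact: expR_gt0.
have r_gt0 : 0 < a * q / 2 by rewrite divr_gt0// mulr_gt0.
have cm_gt0 : 0 < fine (c mu) by exact: fine_gt0 (introT andP (conj c_gt0 c_fin)).
have q_lt1 : q < 1 by rewrite /q -expR0 ltr_expR oppr_lt0 !mulr_gt0.
have aq : a * q < a by rewrite -[ltRHS]mulr1 ltr_pM2l.
split.
- move=> nu nu_on dl; split.
  + exact: (atom_lower M_gt0 c_def mu_on mu_a a_gt0 nu_on).
  + exact: (atom_upper M_gt0 c_def mu_on c_gt0 c_fin mu_a a_gt0 nu_on (lt_trans dl aq)).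
  + rewrite ltr_pdivrMr; last by rewrite subr_gt0 ltr_pdivrMr// mul1r (lt_trans dl).
    rewrite mul1r -[c mu]fineK ?ge0_fin_numE ?(ltW c_gt0)// HM_fin /bondH.
    have -> : 2 * (fine (c mu) * M) = 2 * M * fine (c mu) by ring.
    by rewrite ltrD2l ltrN2 ltr_pdivrMr// mulrC.
- exists (a * q / 2), (2 / (a * M * q)); split => //.
    by rewrite divr_ge0// ltW// !mulr_gt0.
  split => [nu nu_on dl|nu1 nu2 on1 on2 d1 d2].
    by have [] := near_atom M_gt0 c_def mu_on c_gt0 c_fin mu_a a_gt0 nu_on dl.
  rewrite ler_norml; apply/andP; split; last first.
    exact: (atom_lipschitz M_gt0 c_def mu_on c_gt0 c_fin mu_a a_gt0 on1 on2 d1 d2).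
  rewrite lerNl opprB tv_distC.
  exact: (atom_lipschitz M_gt0 c_def mu_on c_gt0 c_fin mu_a a_gt0 on2 on1 d2 d1).
- exists (a * q / 2), ((q^-1 - 1) / (q * M * a ^+ 2)); split => // nu nu_on dl.
  split; first by have [] := near_atom M_gt0 c_def mu_on c_gt0 c_fin mu_a a_gt0 nu_on dl.
  exact: (atom_first_order M_gt0 c_def mu_on c_gt0 c_fin mu_a a_gt0 nu_on dl).
Qed.
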